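(* The uniform measure $\mathbb{P}_{N,\nu}$ on interlacing particle arrays $\{\mathsf{x}^m_j: m=1,\dots,N,\ j=1,\dots,m\}$ with fixed top row $\mathsf{x}^N_j=\nu_j-j$ ($j=1,\dots,N$) is determinantal with correlation kernel given for $1\le n_1\le N$, $1\le n_2\le N-1$ and $x_1,x_2\in\mathbb{Z}$ by $$K(x_1,n_1;x_2,n_2)=-1_{n_2<n_1}1_{x_2\le x_1}\frac{(x_1-x_2+1)_{n_1-n_2-1}}{(n_1-n_2-1)!}$$ $$+\frac{(N-n_1)!}{(N-n_2-1)!}\frac1{(2\pi\mathrm{i})^2}\oint_{\mathfrak{C}(x_2)}dz\oint_{\mathfrak{c}(\infty)}dw\,\frac{(z-x_2+1)_{N-n_2-1}}{(w-x_1)_{N-n_1+1}}\,\frac1{w-z}\prod_{r=1}^N\frac{w+r-\nu_r}{z+r-\nu_r} .$$ The counter-clockwise contour $\mathfrak{C}(x_2)$ in $z$ contains the points $x_2,x_2+1,\dots,\nu_1-1$ and not $x_2-1,x_2-2,\dots,\nu_N-N$. The counter-clockwise contour $\mathfrak{c}(\infty)$ contains $\mathfrak{C}(x_2)$ (without intersecting it) and is sufficiently large to include all the points $x_1,x_1-1,\dots,x_1-(N-n_1)$.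
   Context: Fix an arbitrary $\nu=(\nu_1\ge\dots\ge\nu_N)\in\mathbb{Z}^N$. $\mathbb{P}_{N,\nu}$ is the uniform probability measure on the finite set of integer arrays $\{\mathsf{x}^m_j:1\le j\le m\le N\}$ with $\mathsf{x}^m_{j+1}<\mathsf{x}^{m-1}_j\le\mathsf{x}^m_j$ (whenever defined) and top row $\mathsf{x}^N_j=\nu_j-j$. (Via $\mathsf{x}^m_j=\nu^{(m)}_j-j$ this is the uniform measure on Gelfand-Tsetlin schemes $\nu^{(1)}\prec\dots\prec\nu^{(N)}=\nu$.) ''Correlation kernel'' means: for pairwise distinct $(x_i,n_i)$, $x_i\in\mathbb{Z}$, $1\le n_i\le N-1$, $i=1,\dots,s$, the probability that every $(x_i,n_i)$ is of the form $(\mathsf{x}^m_j,m)$ equals $\det[K(x_i,n_i;x_j,n_j)]_{i,j=1}^s$. Notation: $(y)_0=1$, $(y)_m=y(y+1)\cdots(y+m-1)$; $1_{\{\cdot\}}$ is an indicator; the first summand is $0$ if $n_2\ge n_1$. *)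

(* Defs.v *)
From HB Require Import structures.
From mathcomp Require Import all_boot all_order all_algebra.
From mathcomp Require Import finmap.
From mathcomp Require Import all_classical all_reals all_analysis.
From mathcomp Require Import complex.

Set Implicit Arguments.
Unset Strict Implicit.
Unset Printing Implicit Defensive.

Import Order.TTheory GRing.Theory Num.Theory numFieldNormedType.Exports.

Local Open Scope classical_set_scope.
Local Open Scope ring_scope.
Local Open Scope complex_scope.

(* Parts are numbered from 1: [part nu j] is nu_j, meaningful for 1 <= j <= N. *)
Definition part (N : nat) (nu : N.-tuple int) (j : nat) : int := nth 0 nu j.-1.

(* The pairs (m, j) with 1 <= j <= m <= N, stored as (m - 1, j - 1) and read
   through [level] and [rank]. *)
Definition tri (N : nat) := {p : 'I_N * 'I_N | (p.2 <= p.1)%N}.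
Definition level (N : nat) (p : tri N) : nat := (val p).1.+1.
Definition rank (N : nat) (p : tri N) : nat := (val p).2.+1.

Definition array (N : nat) := {ffun tri N -> int}.

(* With p = (m-1, j), the entry q is (m, j) in the first conjunct and (m, j+1)
   in the second. *)
Definition interlacing (N : nat) (x : array N) : Prop :=
  forall p q : tri N, level q = (level p).+1 ->
    (rank q = rank p -> x p <= x q) /\ (rank q = (rank p).+1 -> x q < x p).

Definition arrays (N : nat) (nu : N.-tuple int) : set (array N) :=
  [set x | interlacing x /\
           forall p : tri N, level p = N -> x p = part nu (rank p) - (rank p)%:Z].

(* [fset_set] sends an infinite set to the empty one; [arrays nu] is finite. *)
Definition uniform_arrays (R : realType) (N : nat) (nu : N.-tuple int)
    (E : set (array N)) : R :=
  #|` fset_set (arrays nu `&` E)|%fset%:R / #|` fset_set (arrays nu)|%fset%:R.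

Definition occupied (N s : nat) (y : 'I_s -> int) (n : 'I_s -> nat) :
    set (array N) :=
  [set x | forall i, exists p : tri N, level p = n i /\ x p = y i].

Definition determinantal (R : realType) (N : nat) (nu : N.-tuple int)
    (K : int -> nat -> int -> nat -> R[i]) : Prop :=
  forall (s : nat) (y : 'I_s -> int) (n : 'I_s -> nat),
    injective (fun i => (y i, n i)) ->
    (forall i, (1 <= n i <= N.-1)%N) ->
    (uniform_arrays R nu (occupied y n))%:C
      = \det (\matrix_(i < s, j < s) K (y i) (n i) (y j) (n j)).

Section contours.
Variable R : realType.
Implicit Types (g : R -> R[i]) (a : R[i]).

Definition C1_on (a b : R) (f : R -> R) : Prop :=
  {within `[a, b], continuous f} /\
  exists2 df : R -> R, {within `[a, b], continuous df} &
    forall t, t \in `]a, b[ -> is_derive t 1 f (df t).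

Definition piecewise_C1 g : Prop :=
  exists2 s : seq R, itv_partition 0 1 s &
    forall i, (i < size s)%N ->
      let u := nth 0 (0 :: s) i in let v := nth 0 (0 :: s) i.+1 in
      C1_on u v (fun t => complex.Re (g t)) /\ C1_on u v (fun t => complex.Im (g t)).

Definition cintegral (f : R -> R[i]) : R[i] :=
  (\int[lebesgue_measure]_(t in `[0, 1]) complex.Re (f t))
    +i* (\int[lebesgue_measure]_(t in `[0, 1]) complex.Im (f t)).

Definition cderive1 g (t : R) : R[i] :=
  derive1 (fun u => complex.Re (g u)) t +i* derive1 (fun u => complex.Im (g u)) t.

Definition contour_integral g (f : R[i] -> R[i]) : R[i] :=
  cintegral (fun t => f (g t) * cderive1 g t).

Definition two_pi_i : R[i] := 0 +i* (2 * pi).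

Definition trace g : set R[i] := g @` `[0, 1].

Definition winding g a : R[i] :=
  two_pi_i^-1 * contour_integral g (fun z => (z - a)^-1).

Definition encloses g a : Prop := ~ trace g a /\ winding g a = 1.
Definition excludes g a : Prop := ~ trace g a /\ winding g a = 0.

(* By the Jordan curve theorem the winding number of a simple closed curve is 0
   outside it and constantly 1 or constantly -1 inside; the last clause says
   that the curve is counter-clockwise. *)
Definition ccw_contour g : Prop :=
  [/\ piecewise_C1 g,
      g 0 = g 1,
      {in `[0, 1[ &, injective g} &
      forall a, ~ trace g a -> encloses g a \/ excludes g a].

End contours.

Definition pochhammer (T : pzRingType) (y : T) (m : nat) : T :=
  \prod_(k < m) (y + k%:R).

Section correlation_kernel.
Variables (R : realType) (N : nat) (nu : N.-tuple int).

Definition z_contour (x2 : int) (gz : R -> R[i]) : Prop :=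
  [/\ ccw_contour gz,
      forall k : int, x2 <= k -> k <= part nu 1 - 1 -> encloses gz k%:~R &
      forall k : int, part nu N - N%:Z <= k -> k <= x2 - 1 ->
        excludes gz k%:~R].

Definition w_contour (x1 : int) (n1 : nat) (gz gw : R -> R[i]) : Prop :=
  [/\ ccw_contour gw,
      forall a, trace gz a -> encloses gw a &
      forall k : nat, (k <= N - n1)%N -> encloses gw (x1 - k%:Z)%:~R].

Definition integrand (x1 : int) (n1 : nat) (x2 : int) (n2 : nat)
    (z w : R[i]) : R[i] :=
  pochhammer (z - x2%:~R + 1) (N - n2 - 1)
    / pochhammer (w - x1%:~R) (N - n1 + 1)
    * (w - z)^-1
    * \prod_(1 <= r < N.+1)
        ((w + r%:R - (part nu r)%:~R) / (z + r%:R - (part nu r)%:~R)).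

Definition corr_kernel (gz gw : R -> R[i])
    (x1 : int) (n1 : nat) (x2 : int) (n2 : nat) : R[i] :=
  - ((n2 < n1)%N%:R * (x2 <= x1)%R%:R
      * (pochhammer (x1 - x2 + 1)%:~R (n1 - n2 - 1) / ((n1 - n2 - 1)`!)%:R))
  + ((N - n1)`!)%:R / ((N - n2 - 1)`!)%:R
    * ((two_pi_i R ^+ 2)^-1
       * contour_integral gz (fun z =>
           contour_integral gw (fun w => integrand x1 n1 x2 n2 z w))).

End correlation_kernel.

(* Main.v *)
(** The weight of an array is a product over its levels, and a row interlaces
    with the next one exactly when its particles lie in prescribed disjoint
    intervals. By multilinearity, summing a determinant over these intervals
    gives a determinant of differences, i.e. a determinant with one more column
    of ones; so the generating function of the occupied points is the
    determinant of iterated cumulated sums evaluated at the top row. Without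
    weights these sums are binomials, which span the polynomials of degree less
    than N and which Lagrange interpolation at the top row inverts. Sylvester's
    identity then turns the weighted determinant into a Fredholm determinant
    det (1 + K C) on the given points, from which inclusion-exclusion extracts
    the correlation functions. Here K is minus the number of chains between two
    points plus the sum over the top particles t of (chains from the second
    point to t) times (backward difference of order N - n1, at x1, of the
    Lagrange polynomial of t).

    In the double contour integral every pole of the w-integrand is enclosed,
    so that only the value at z of the polynomial part of
    prod (w - t) / (w - x1)_(N - n1 + 1) survives; at z = t it is, up to
    (N - n1)!, the backward difference of prod_(t' <> t) (w - t'). The remaining
    z-integral is the sum of the residues at the particles t >= x2. *)

Require Import Defs.
From HB Require Import structures.
From mathcomp Require Import all_boot all_order all_algebra.
From mathcomp Require Import fingroup perm ring zify.

Set Implicit Arguments.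
Unset Strict Implicit.
Unset Printing Implicit Defensive.

Import Order.TTheory GRing.Theory Num.Theory.

Local Open Scope ring_scope.

(** * Backward differences *)

Section backward_difference.
Context {F : numFieldType}.
Implicit Types (f g : int -> F) (x : int) (p : {poly F}).

Definition nabla f x : F := f x - f (x - 1).

Lemma eq_iter_nabla n f g : f =1 g -> iter n nabla f =1 iter n nabla g.
Proof. by move=> fg; elim: n => //= n IH x; rewrite /nabla !IH. Qed.

Lemma iter_nablaD n f g x :
  iter n nabla (fun x => f x + g x) x = iter n nabla f x + iter n nabla g x.
Proof. by elim: n x => //= n IH x; rewrite /nabla !IH; ring. Qed.

Lemma iter_nablaZ n c f x : iter n nabla (fun x => c * f x) x = c * iter n nabla f x.
Proof. by elim: n x => //= n IH x; rewrite /nabla !IH mulrBr. Qed.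

Lemma iter_nabla0 n x : iter n nabla (fun=> 0) x = 0.
Proof. by elim: n x => //= n IH x; rewrite /nabla !IH subrr. Qed.

Lemma iter_nabla_sum n (I : Type) (r : seq I) (f : I -> int -> F) x :
  iter n nabla (fun x => \sum_(i <- r) f i x) x = \sum_(i <- r) iter n nabla (f i) x.
Proof.
elim: r => [|i r IH].
  rewrite big_nil -[RHS](iter_nabla0 n x); apply: eq_iter_nabla => y.
  by rewrite big_nil.
rewrite big_cons -IH -iter_nablaD; apply: eq_iter_nabla => y.
by rewrite big_cons.
Qed.

(** The n-th difference at [x] reads [f] only at x, x - 1, ..., x - n. *)
Lemma iter_nabla_eq0 n f x :
  (forall k : nat, (k <= n)%N -> f (x - k%:Z) = 0) -> iter n nabla f x = 0.
Proof.
elim: n x => [|n IH] x fx /=; first by rewrite -[x]subr0; exact: (fx 0%N).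
rewrite /nabla !IH ?subr0// => k kn; last by apply: fx; exact: leqW.
by rewrite -addrA -opprD -(fx k.+1)//; congr f; lia.
Qed.

Variable a : int.

(* [rising_poly i] takes the value binomial(u + i, i) at [a + u]. *)
Definition rising_poly (i : nat) : {poly F} :=
  (i`!%:R)^-1 *: \prod_(j < i) ('X + ((j.+1%:Z - a)%:~R)%:P).

Lemma rising_polyE i s :
  (rising_poly i).[s] = \prod_(j < i) (s + (j.+1%:Z - a)%:~R) / i`!%:R.
Proof.
rewrite hornerZ mulrC horner_prod; congr (_ / _).
by apply: eq_bigr => j _; rewrite hornerD hornerX hornerC.
Qed.

Lemma factF_neq0 i : i`!%:R != 0 :> F.
Proof. by rewrite pnatr_eq0 -lt0n fact_gt0. Qed.

Lemma rising_poly_nat i (u : nat) :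
  (rising_poly i).[(a + u%:Z)%:~R] = 'C(u + i, i)%:R.
Proof.
have E : ('C(u + i, i) * i`!)%N%:R = \prod_(j < i) (u + j.+1)%N%:R :> F.
  rewrite bin_ffact; elim: i => [|i IH]; first by rewrite big_ord0 ffactn0.
  by rewrite big_ord_recr/= -IH addnS ffactSS mulnC natrM.
apply/(mulIf (factF_neq0 i)); rewrite -natrM E rising_polyE divfK ?factF_neq0//.
apply: eq_bigr => j _; rewrite pmulrn -rmorphD/=; congr (_%:~R); lia.
Qed.

(** Pascal's rule in polynomial form, hence valid at every integer and not only to the right of [a]:
    the products at x and x - 1 share i factors, and the remaining two differ by i + 1. *)
Lemma nabla_rising_poly i x :
  nabla (fun x => (rising_poly i.+1).[x%:~R]) x = (rising_poly i).[x%:~R].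
Proof.
rewrite /nabla !rising_polyE big_ord_recr big_ord_recl /=.
rewrite [in X in _ - X](eq_bigr (fun j : 'I_i => x%:~R + (j.+1%:Z - a)%:~R)); last first.
  move=> j _; rewrite -!rmorphD/= /bump /=; congr (_%:~R).
  by rewrite (_ : (true + j).+1%:Z = j.+1%:Z + 1); [ring|lia].
have := factF_neq0 i; have := factF_neq0 i.+1; rewrite factS natrM.
move: (\prod_(j < i) _) => c; rewrite mulf_eq0 negb_or => /andP[n1 _] n2.
rewrite !rmorphB/= rmorph1 -!pmulrn.
by field; rewrite nat1r n1 n2.
Qed.

Lemma iter_nabla_rising_poly n i x :
  iter n nabla (fun x => (rising_poly i).[x%:~R]) x =
  if (n <= i)%N then (rising_poly (i - n)).[x%:~R] else 0.
Proof.
elim: n i x => [|n IH] i x /=; first by rewrite subn0.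
rewrite -iterS iterSr; case: i => [|i].
  rewrite ltn0 -[RHS](iter_nabla0 n x); apply: eq_iter_nabla => y.
  by rewrite /nabla !rising_polyE !big_ord0 subrr.
by rewrite (eq_iter_nabla n (nabla_rising_poly i)) IH ltnS subSS.
Qed.

Lemma size_rising_poly i : size (rising_poly i) = i.+1.
Proof.
rewrite size_scale ?invr_eq0 ?factF_neq0//.
under eq_bigr do rewrite -[X in 'X + X]opprK -rmorphN.
by rewrite size_prod_XsubC [index_enum _]unlock -enumT size_enum_ord.
Qed.

Lemma rising_poly_lead i : (rising_poly i)`_i = (i`!%:R)^-1.
Proof.
rewrite coefZ -[RHS]mulr1; congr (_ * _).
under eq_bigr do rewrite -[X in 'X + X]opprK -rmorphN.
set P := \prod_(j < i) _.
have : lead_coef P = 1 by apply/monicP; exact: monic_prod_XsubC.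
by rewrite /lead_coef /P size_prod_XsubC [index_enum _]unlock -enumT size_enum_ord.
Qed.

Lemma rising_poly_basis n p : (size p <= n)%N ->
  exists h : nat -> F, p = \sum_(i < n) h i *: rising_poly i.
Proof.
elim: n p => [|n IH] p pn.
  by exists (fun=> 0); rewrite big_ord0; apply/eqP; rewrite -size_poly_leq0.
(* [rising_poly n] has leading coefficient 1/n!, so this multiple cancels the coefficient of X^n. *)
have [|h hE] := IH (p - (p`_n * n`!%:R) *: rising_poly n).
  apply/leq_sizeP => j; rewrite leq_eqVlt => /orP[/eqP<-|nj].
    by rewrite coefB coefZ rising_poly_lead mulfK ?factF_neq0// subrr.
  rewrite coefB coefZ [(rising_poly n)`_j]nth_default ?size_rising_poly//.
  by rewrite mulr0 subr0 nth_default//; exact: leq_trans pn nj.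
exists (fun i => if i == n then p`_n * n`!%:R else h i).
rewrite big_ord_recr/= eqxx -[LHS](subrK ((p`_n * n`!%:R) *: rising_poly n)) hE.
by congr (_ + _); apply: eq_bigr => i _; rewrite ltn_eqF.
Qed.

(** In the basis of rising polynomials, n differences annihilate every term of degree below n and
    turn the last one into a constant. *)
Lemma iter_nabla_poly n p x : (size p <= n.+1)%N ->
  iter n nabla (fun x => p.[x%:~R]) x = n`!%:R * p`_n.
Proof.
move=> /rising_poly_basis[h ->].
rewrite (@eq_iter_nabla _ _ (fun x => \sum_(i < n.+1) h i * (rising_poly i).[x%:~R])).
  rewrite iter_nabla_sum coef_sum !big_ord_recr/= !big1 ?add0r => [|i _|i _].
  - rewrite iter_nablaZ iter_nabla_rising_poly leqnn subnn coefZ rising_poly_lead.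
    by rewrite rising_polyE big_ord0 fact0 divr1 mulrCA mulfV ?factF_neq0.
  - by rewrite coefZ nth_default ?mulr0// size_rising_poly.
  - by rewrite iter_nablaZ iter_nabla_rising_poly leqNgt ltn_ord mulr0.
by move=> y; rewrite horner_sum; apply: eq_bigr => i _; rewrite hornerZ.
Qed.

End backward_difference.

Section quotient.
Context {F : numFieldType}.

(* Writing G = B Q + S, the quotient of (X - t) G by Q is (X - t) B + s with s
   the coefficient of X^q in S, and the q-th difference of G at x is q! s. *)
Lemma quotient_nabla (t x : int) (q : nat) (G : {poly F}) :
  let Q := \prod_(k < q.+1) ('X - ((x - k%:Z)%:~R)%:P) in
  q`!%:R * ((('X - (t%:~R)%:P) * G) %/ Q).[t%:~R]
  = iter q nabla (fun y => G.[y%:~R]) x.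
Proof.
move=> Q.
have szQ : size Q = q.+2 by rewrite size_prod_XsubC [index_enum _]unlock -enumT size_enum_ord.
have Q_monic : Q`_q.+1 = 1.
  have : lead_coef Q = 1 by apply/monicP; exact: monic_prod_XsubC.
  by rewrite /lead_coef szQ.
have Q0 : Q != 0 by rewrite -size_poly_eq0 szQ.
set B := G %/ Q; set S := G %% Q.
have GE : G = B * Q + S := divp_eq G Q.
have szS : (size S <= q.+1)%N by rewrite -ltnS -szQ ltn_modp.
have szD : (size (('X - (t%:~R)%:P) * S - S`_q *: Q)%R < size Q)%N.
  rewrite szQ ltnS; apply/leq_sizeP => j; rewrite leq_eqVlt => /orP[/eqP<-|qj].
    rewrite mulrBl !coefB coefXM coefCM coefZ Q_monic /=.
    by rewrite [S`_q.+1]nth_default// mulr0 subr0 mulr1 subrr.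
  case: j qj => // j; rewrite ltnS => qj.
  rewrite mulrBl !coefB coefXM coefCM coefZ /=.
  have Sq i : (q < i)%N -> S`_i = 0 by move=> qi; rewrite nth_default// (leq_trans szS).
  by rewrite (Sq _ qj) (Sq _ (leqW qj)) [Q`_j.+1]nth_default ?szQ// !mulr0 !subr0.
have -> : ('X - (t%:~R)%:P) * G =
    (('X - (t%:~R)%:P) * B + (S`_q)%:P) * Q + (('X - (t%:~R)%:P) * S - S`_q *: Q).
  by rewrite GE -mul_polyC; ring.
rewrite divp_addl_mul_small// hornerD hornerM hornerXsubC subrr mul0r add0r hornerC.
rewrite (@eq_iter_nabla _ _ _ (fun y => (B * Q).[y%:~R] + S.[y%:~R])); last first.
  by move=> y; rewrite [in LHS]GE hornerD.
rewrite iter_nablaD [X in _ + X]iter_nabla_poly// iter_nabla_eq0 ?add0r// => k kq.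
(* The q-th difference at [x] only reads the roots x - k of [Q], where B Q vanishes. *)
rewrite hornerM horner_prod (bigD1 (Ordinal (kq : k < q.+1)%N))//=.
by rewrite hornerXsubC subrr mul0r mulr0.
Qed.

End quotient.

(** * Cumulated sums over interlacing arrays *)

Section cumulated_sums.
Context {F : comNzRingType} (w : nat -> nat -> F).

(** The weighted sum over chains u >= v_1 >= ... >= v_i >= 0 with v_k placed on level m - k. *)
Fixpoint cumsum (m i u : nat) : F :=
  if i is i'.+1 then \sum_(v < u.+1) w m.-1 v * cumsum m.-1 i' v else 1.

Definition cumsum_mx n (x : 'I_n -> nat) : 'M[F]_n :=
  \matrix_(j < n, i < n) cumsum n i (x j).

Definition interlaced n L (y : {ffun 'I_n -> 'I_L}) (x : {ffun 'I_n.+1 -> 'I_L}) :=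
  [forall j : 'I_n, (x (lift ord0 j) < y j)%N && (y j <= x (widen_ord (leqnSn n) j))%N].

(* Subtracting from each row the next one turns the column of ones into a unit
   vector and each cumulated sum into a sum over the interval available to the
   corresponding lower particle. *)
Lemma det_cumsum_mx_rec n L (x : {ffun 'I_n.+1 -> 'I_L}) :
  (forall j : 'I_n, (x (lift ord0 j) <= x (widen_ord (leqnSn n) j))%N) ->
  \sum_(y : {ffun 'I_n -> 'I_L} | interlaced y x)
     (\prod_j w n (y j)) * \det (cumsum_mx (fun j => y j))
  = (-1) ^+ n * \det (cumsum_mx (fun j => x j)).
Proof.
move=> xdec.
pose I (j : 'I_n) (v : 'I_L) :=
  (x (lift ord0 j) < v)%N && (v <= x (widen_ord (leqnSn n) j))%N.
(* The intervals [I j] are independent of each other, so multilinearity moves the sum over [y] into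
   the rows. *)
transitivity (\det (\matrix_(j < n, i < n) \sum_(v | I j v) w n v * cumsum n i v)).
  rewrite [RHS]/(\det _).
  under eq_bigr do rewrite /(\det _) mulr_sumr.
  rewrite exchange_big /=; apply: eq_bigr => s _.
  under [in RHS]eq_bigr do rewrite mxE.
  rewrite bigA_distr_big_dep mulr_sumr; apply: eq_big => [y|y _].
    by apply/forallP/familyP => h j; have := h j.
  rewrite mulrCA big_split /=; congr (_ * (_ * _)).
  by apply: eq_bigr => j _; rewrite mxE.
pose L1 : 'M[F]_n.+1 := \matrix_(j, k) ((k == j :> nat)%:R - (k == j.+1 :> nat)%:R).
have detL : \det L1 = 1.
  rewrite -det_tr det_trig; last first.
    apply/is_trig_mxP => i j ij; rewrite !mxE.
    by rewrite ltn_eqF// ltn_eqF ?subrr// ltnW.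
  rewrite big1// => i _; rewrite !mxE eqxx.
  by rewrite ltn_eqF ?subr0.
(* The last row has no successor and stays unchanged: there [insub] gives [None]. *)
have LM (j i : 'I_n.+1) : (L1 *m cumsum_mx (fun j => x j)) j i =
    cumsum n.+1 i (x j) - (if insub j.+1 is Some k then cumsum n.+1 i (x k) else 0).
  rewrite mxE; under eq_bigr do rewrite !mxE mulrBl.
  rewrite big_split /= sumrN; congr (_ - _).
    rewrite (bigD1 j)//= eqxx mul1r big1 ?addr0// => k kj.
    by rewrite (_ : (k == j :> nat) = false) ?mul0r//; apply/negbTE.
  case: insubP => [k _ kE|jn].
    rewrite (bigD1 k)//= kE eqxx mul1r big1 ?addr0// => l lk.
    rewrite -kE (_ : (l == k :> nat) = false) ?mul0r//; exact/negbTE.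
  rewrite big1// => k _; case: eqP => [kj|]; last by rewrite mul0r.
  by move: jn; rewrite -kj ltn_ord.
(* Column 0 of the product vanishes except for a last entry 1; the sign of its cofactor cancels
   (-1)^n. *)
rewrite -[X in _ * X]mul1r -[X in _ * (X * _)]detL -det_mulmx (expand_det_col _ ord0).
rewrite (bigD1 ord_max)//= big1 ?addr0 => [|j jmax]; last first.
  rewrite LM /=; case: insubP => [k _ _|]; first by rewrite subrr mul0r.
  rewrite -leqNgt ltnS => nj; case/eqP: jmax; apply/val_inj => /=; apply/eqP.
  by rewrite eqn_leq nj -ltnS ltn_ord.
rewrite LM insubN ?ltnn//= subr0 mul1r /cofactor /= addn0. rewrite mulrA -exprD addnn.
rewrite -mul2n exprM sqrrN expr1n expr1n mul1r; congr (\det _).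
apply/matrixP => j i; rewrite 3!mxE LM.
have jE : lift ord_max j = widen_ord (leqnSn n) j by apply/val_inj; exact: lift_max.
have iE : (lift ord0 i : nat) = i.+1 by [].
case: insubP => [k _ kE|]; last by rewrite jE /= ltnS ltn_ord.
have -> : k = lift ord0 j by apply/val_inj; rewrite kE jE.
rewrite jE iE /= !(big_ord_widen L (fun v => w n v * cumsum n i v)) ?ltn_ord//=.
(* The sum up to x_j is cut at x_(j+1); what remains ranges over [I j]. *)
rewrite [X in _ = X - _](bigID (fun v : 'I_L => v < (x (lift ord0 j)).+1)%N) /=.
rewrite [X in _ = X + _ - _](eq_bigl (fun v : 'I_L => v < (x (lift ord0 j)).+1)%N).
  rewrite addrC addKr.
  by apply: eq_bigl => v; rewrite ltnS -ltnNge andbC.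
move=> v /=; rewrite andb_idl// !ltnS => /leq_trans; apply; exact: xdec.
Qed.
End cumulated_sums.

(** * Weighted sums over interlacing arrays with bounded positions *)

Section finite_arrays.
Variable L : nat.
Local Notation farray n := {ffun tri n -> 'I_L}.

Lemma tri_eq n (p q : tri n) : level p = level q -> rank p = rank q -> p = q.
Proof.
case: p q => [[i j] h] [[i' j'] h'] [/val_inj/= ii] [/val_inj/= jj].
by apply/val_inj; rewrite /= ii jj.
Qed.

Lemma level_le n (p : tri n) : (level p <= n)%N. Proof. exact: ltn_ord. Qed.

Lemma rank_le n (p : tri n) : (rank p <= level p)%N. Proof. exact: (valP p). Qed.

Lemma tri_exists n m r : (0 < r <= m)%N -> (m <= n)%N ->
  exists p : tri n, level p = m /\ rank p = r.
Proof.
case: r m => [//|r] [//|m] /= rm mn.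
have rn : (r < n)%N by apply: leq_trans mn.
by exists (exist _ (Ordinal mn, Ordinal rn) rm).
Qed.

Definition interlacingb n (f : farray n) : bool :=
  [forall p : tri n, [forall q : tri n, (level q == (level p).+1) ==>
    ((rank q == rank p) ==> (f p <= f q)%N) &&
    ((rank q == (rank p).+1) ==> (f q < f p)%N)]].

Lemma interlacingbP n (f : farray n) :
  reflect (forall p q : tri n, level q = (level p).+1 ->
    (rank q = rank p -> (f p <= f q)%N) /\
    (rank q = (rank p).+1 -> (f q < f p)%N)) (interlacingb f).
Proof.
apply: (iffP 'forall_forallP) => h p q.
  by move=> /eqP pq; have /implyP/(_ pq)/andP[/implyP h1 /implyP h2] := h p q;
    split=> /eqP.
apply/implyP => /eqP pq; have [h1 h2] := h p q pq.
by apply/andP; split; apply/implyP => /eqP.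
Qed.

Fact top_subproof n (j : 'I_n) : (n.-1 < n)%N. Proof. by case: n j => [[]|]. Qed.
Fact top_subproof2 n (j : 'I_n) : (j <= n.-1)%N.
Proof. by case: n j => [[]//|n j]; rewrite -ltnS ltn_ord. Qed.

Definition top_index n (j : 'I_n) : tri n :=
  exist (fun p : 'I_n * 'I_n => (p.2 <= p.1)%N)
    (Ordinal (top_subproof j), j) (top_subproof2 j).

Lemma level_top n (j : 'I_n) : level (top_index j) = n.
Proof. by case: n j => [[]|]. Qed.

Lemma rank_top n (j : 'I_n) : rank (top_index j) = j.+1. Proof. by []. Qed.

Lemma top_indexP n (p : tri n) : level p = n -> p = top_index (val p).2.
Proof. by move=> pn; apply: tri_eq; rewrite ?level_top. Qed.

Definition row_top n (f : farray n) : {ffun 'I_n -> 'I_L} :=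
  [ffun j => f (top_index j)].

Definition widen_tri n (p : tri n) : tri n.+1 :=
  exist (fun p : 'I_n.+1 * 'I_n.+1 => (p.2 <= p.1)%N)
    (widen_ord (leqnSn n) (val p).1, widen_ord (leqnSn n) (val p).2) (valP p).

Lemma level_widen n (p : tri n) : level (widen_tri p) = level p. Proof. by []. Qed.
Lemma rank_widen n (p : tri n) : rank (widen_tri p) = rank p. Proof. by []. Qed.

Lemma widen_tri_inj n : injective (@widen_tri n).
Proof.
move=> p q pq; apply: tri_eq.
  by rewrite -level_widen pq.
by rewrite -rank_widen pq.
Qed.

Lemma tri_cases n (p : tri n.+1) :
  (exists q : tri n, p = widen_tri q) \/ p = top_index (val p).2.
Proof.
have := level_le p; rewrite leq_eqVlt => /orP[/eqP/top_indexP|]; first by right.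
rewrite ltnS => pn; left.
have [|q [lq rq]] := @tri_exists n (level p) (rank p) _ pn.
  exact: rank_le.
by exists q; apply: tri_eq; rewrite ?level_widen ?rank_widen.
Qed.

(** With [drop_row] and [row_top] this gives the bijection between arrays with n + 1 levels and
    pairs of an array with n levels and a new top row, on which the induction over levels rests.
    [pick] recovers the preimage under [widen_tri], if there is one. *)
Definition add_row n (g : farray n) (x : {ffun 'I_n.+1 -> 'I_L}) : farray n.+1 :=
  [ffun p => if [pick q | widen_tri q == p] is Some q then g q else x (val p).2].

Definition drop_row n (f : farray n.+1) : farray n := [ffun q => f (widen_tri q)].

Lemma add_row_widen n (g : farray n) x q : add_row g x (widen_tri q) = g q.
Proof.
rewrite ffunE; case: pickP => [q' /eqP/widen_tri_inj->//|/(_ q)].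
by rewrite eqxx.
Qed.

Lemma add_row_top n (g : farray n) x j : add_row g x (top_index j) = x j.
Proof.
rewrite ffunE; case: pickP => [q /eqP E|//].
by have := level_le q; rewrite -level_widen E level_top ltnn.
Qed.

Lemma row_top_add n (g : farray n) x : row_top (add_row g x) = x.
Proof. by apply/ffunP => j; rewrite ffunE add_row_top. Qed.

Lemma drop_add_row n (g : farray n) x : drop_row (add_row g x) = g.
Proof. by apply/ffunP => q; rewrite ffunE add_row_widen. Qed.

Lemma add_drop_row n (f : farray n.+1) : add_row (drop_row f) (row_top f) = f.
Proof.
apply/ffunP => p; have [[q ->]|->] := tri_cases p.
  by rewrite add_row_widen ffunE.
by rewrite add_row_top ffunE.
Qed.

Lemma interlacing_add_row n (g : farray n) x :
  interlacingb (add_row g x) = interlacingb g && interlaced (row_top g) x.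
Proof.
apply/interlacingbP/andP => [h|[/interlacingbP h /forallP hx] p q pq].
  split.
    apply/interlacingbP => p q pq.
    by have := h (widen_tri p) (widen_tri q) pq; rewrite !add_row_widen.
  apply/forallP => j; rewrite ffunE.
  have lw : level (widen_tri (top_index j)) = n by rewrite level_widen level_top.
  have [_ h1] := h (widen_tri (top_index j)) (top_index (lift ord0 j))
    (etrans (level_top _) (esym (congr1 S lw))).
  have [h2 _] := h (widen_tri (top_index j)) (top_index (widen_ord (leqnSn n) j))
    (etrans (level_top _) (esym (congr1 S lw))).
  by move: (h1 erefl) (h2 erefl); rewrite !add_row_widen !add_row_top => -> ->.
have [[p' pE]|pE] := tri_cases p; last first.
  by have := level_le q; rewrite pq pE level_top ltnn.
subst p; have [[q' qE]|qE] := tri_cases q.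
  by subst q; rewrite !add_row_widen; exact: h.
rewrite qE add_row_widen add_row_top.
have p'n : level p' = n.
  by move: pq; rewrite qE level_top level_widen => -[].
have E : g p' = row_top g (val p').2 by rewrite ffunE -(top_indexP p'n).
have /andP[h1 h2] := hx (val p').2.
rewrite E; split => rk.
  rewrite (_ : (val q).2 = widen_ord (leqnSn n) (val p').2)//.
  by apply/val_inj; case: rk.
rewrite (_ : (val q).2 = lift ord0 (val p').2)//.
by apply/val_inj; case: rk.
Qed.

(** Each inner entry of the longer row separates two neighbours of the shorter one: y_(j+1) <=
    x_(j+1) < y_j. *)
Lemma interlaced_noninc n (y : {ffun 'I_n.+1 -> 'I_L}) x (j : 'I_n) :
  interlaced y x -> (y (lift ord0 j) <= y (widen_ord (leqnSn n) j))%N.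
Proof.
move=> /forallP h.
have /andP[_ h1] := h (lift ord0 j).
have /andP[h2 _] := h (widen_ord (leqnSn n) j).
apply: (leq_trans h1); apply: ltnW; rewrite (leq_trans _ h2)//.
by rewrite ltnS (_ : lift ord0 _ = widen_ord (leqnSn n.+1) (lift ord0 j))//; apply/val_inj.
Qed.

Variables (F : comNzRingType) (w : nat -> nat -> F).

(** The top row carries no weight; a row receives its weights once another row is put on top of
    it. *)
Definition array_weight n (f : farray n) : F := \prod_(p | (level p < n)%N) w (level p) (f p).

Lemma array_weight_add_row n (g : farray n) x :
  array_weight (add_row g x) = array_weight g * \prod_j w n (row_top g j).
Proof.
have -> : array_weight (add_row g x) = \prod_(q : tri n) w (level q) (g q).
  rewrite /array_weight (eq_bigl (fun p => p \in @widen_tri n @: [set: tri n])).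
    rewrite big_imset /=; last by move=> p q _ _; exact: widen_tri_inj.
    by apply: eq_big => [q|q _]; rewrite ?inE// add_row_widen.
  move=> p; apply/idP/imsetP => [pn|[q _ ->]]; last by rewrite ltnS level_widen level_le.
  have [[q ->]|E] := tri_cases p; first by exists q.
  by move: pn; rewrite E level_top ltnn.
rewrite (bigID (fun q : tri n => level q < n)%N) /=; congr (_ * _).
rewrite (eq_bigl (fun p => p \in @top_index n @: [set: 'I_n])).
  rewrite big_imset /=; last by move=> i j _ _ [].
  by apply: eq_big => [j|j _]; rewrite ?inE// ffunE level_top.
move=> p; rewrite -leqNgt; apply/idP/imsetP => [pn|[j _ ->]]; last by rewrite level_top.
exists (val p).2 => //; apply: top_indexP; apply/eqP.
by rewrite eqn_leq level_le.
Qed.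

(** Induction on the number of levels, with [det_cumsum_mx_rec] at each of them; the signs (-1)^k
    for k < n multiply to the stated one. *)
Lemma sum_array_weight n (x : {ffun 'I_n -> 'I_L}) :
  (forall i j : 'I_n, j = i.+1 :> nat -> (x j <= x i)%N) ->
  \sum_(f : farray n | interlacingb f && (row_top f == x)) array_weight f
  = (-1) ^+ 'C(n, 2) * \det (cumsum_mx w (fun j => x j)).
Proof.
elim: n x => [|n IH] x xdec.
  rewrite det_mx00 bin_small// expr0 mulr1.
  have tri0 : tri 0 -> False by case=> -[[]].
  have f0 : farray 0 := [ffun p => False_rect _ (tri0 p)].
  rewrite (bigD1 f0)/= ?big1 ?addr0.
  - by rewrite /array_weight big1// => p; case: (tri0 p).
  - move=> f /andP[_ /eqP[]]; apply/ffunP => p; by case: (tri0 p).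
  - apply/andP; split; last by apply/eqP/ffunP => -[].
    by apply/interlacingbP => p; case: (tri0 p).
rewrite (reindex_onto (fun g => add_row g x) (@drop_row n)) /=; last first.
  by move=> f /andP[_ /eqP <-]; exact: add_drop_row.
under eq_bigl do rewrite drop_add_row eqxx andbT row_top_add eqxx andbT interlacing_add_row.
under eq_bigr do rewrite array_weight_add_row.
(* The smaller arrays are grouped by their top row [y], to which the induction hypothesis
   applies. *)
rewrite (partition_big (@row_top n) (fun y => interlaced y x)) /=; last first.
  by move=> g /andP[].
rewrite binS bin1 exprD -mulrA -det_cumsum_mx_rec; last first.
  by move=> j; apply: xdec; rewrite /= /bump.
rewrite mulr_sumr; apply: eq_bigr => y yx.
rewrite mulrCA -IH; last first.
  move=> i j ij; clear IH xdec; move: n y x yx i j ij => [|n] y x yx i j ij; first by case: (i) => [] [].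
  have i_n : (i < n)%N by rewrite -ltnS -ij ltn_ord.
  have := interlaced_noninc (Ordinal i_n) yx.
  rewrite (_ : lift ord0 _ = j); last by apply/val_inj; exact: esym ij.
  by rewrite (_ : widen_ord _ _ = i)//; apply/val_inj.
rewrite mulr_sumr (eq_bigl (fun g => interlacingb g && (row_top g == y))); last first.
  by move=> g; case: (eqVneq (row_top g) y) => [->|]; rewrite ?andbF// yx !andbT.
by apply: eq_bigr => g /andP[_ /eqP <-]; rewrite mulrC.
Qed.

End finite_arrays.

(** * The correlation kernel as a finite-dimensional determinant *)

Section determinants.
Context {F : fieldType}.

(** Sylvester's identity, read off from two block triangular factorizations of one matrix. *)
Lemma det_1addmulC m n (A : 'M[F]_(m, n)) (B : 'M[F]_(n, m)) :
  \det (1%:M + A *m B) = \det (1%:M + B *m A).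
Proof.
have E1 : block_mx 1%:M (- A) B 1%:M =
    block_mx 1%:M (- A) 0 1%:M *m block_mx (1%:M + A *m B) 0 B 1%:M.
  by rewrite mulmx_block !mulmx1 !mul1mx !mulmx0 !mul0mx !add0r mulNmx addrK.
have E2 : block_mx 1%:M (- A) B 1%:M =
    block_mx 1%:M 0 B 1%:M *m block_mx 1%:M (- A) 0 (1%:M + B *m A).
  rewrite mulmx_block !mulmx1 !mul1mx !mulmx0 !mul0mx !addr0.
  by rewrite mulmxN addrC addrK.
have := congr1 determinant E2; rewrite E1 !det_mulmx !det_ublock !det_lblock !det1.
by rewrite !mul1r mulr1.
Qed.

(* In the Leibniz expansion a permutation contributes only if it never
   increases [d], hence it preserves [d], hence it fixes every index. *)
Lemma det_1sub_graded s (d : 'I_s -> nat) (X : 'M[F]_s) :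
  (forall l k, ~~ (d k < d l)%N -> X l k = 0) -> \det (1%:M - X) = 1.
Proof.
move=> X0; rewrite /(\det _) (bigD1 (1%g : 'S_s)) //= odd_perm1 expr0 mul1r.
rewrite big1 => [|l _]; last by rewrite perm1 !mxE eqxx X0 ?ltnn ?subr0.
rewrite big1 ?addr0// => p p1.
have [/existsP[l lP]|] := boolP [exists l, (1%:M - X) l (p l) == 0].
  by rewrite (bigD1 l)//= (eqP lP) mul0r mulr0.
rewrite negb_exists => /forallP nz; case/eqP: p1.
have dle l : (d (p l) < d l)%N || (p l == l).
  have := nz l; rewrite !mxE; apply: contraR; rewrite negb_or => /andP[dl /negbTE pl].
  by rewrite X0// (eq_sym l) pl subrr.
have dle' l : (d (p l) <= d l)%N.
  by have /orP[/ltnW//|/eqP->] := dle l.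
have sumd : \sum_l d (p l) = \sum_l d l by rewrite [RHS](reindex_inj (@perm_inj _ p)).
apply/permP => l; rewrite perm1; apply/eqP; have /orP[dl|//] := dle l.
have := leqnn (\sum_l d l); rewrite -{1}sumd.
have : (\sum_l d (p l) < \sum_l d l)%N.
  rewrite (bigD1 l)//= [X in (_ < X)%N](bigD1 l)//= -addSn leq_add//.
  by apply: leq_sum => i _.
by rewrite sumd ltnn.
Qed.

End determinants.

(** * Expansion of the cumulated sums along marked points *)

Section expansion.
Context {F : fieldType} (s : nat) (d u : 'I_s -> nat) (c : 'I_s -> F).

(** If the points are distinct, the weight is 1 + c_k at the k-th one and 1 elsewhere; the c_k are
    the variables of the generating function. *)
Definition point_weight (m v : nat) : F := 1 + \sum_k c k * ((d k == m) && (u k == v))%:R.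

Local Notation w := point_weight.

(* The number of chains [a <= v_1 <= ... <= v_(e-1) <= b]. *)
Definition chains (e a b : nat) : F := (a <= b)%N%:R * 'C(b - a + e.-1, e.-1)%:R.

Lemma sum_bin_diag i b : (\sum_(v < b.+1) 'C(v + i, i) = 'C(b + i.+1, i.+1))%N.
Proof.
elim: b => [|b IH]; first by rewrite big_ord1 !binn.
by rewrite big_ord_recr /= IH !addSn [RHS]binS addnS.
Qed.

Lemma sum_chains e a b : (0 < e)%N -> \sum_(v < b.+1) chains e a v = chains e.+1 a b.
Proof.
case: e => // e _; rewrite /chains /=; case: leqP => ab; last first.
  rewrite mul0r big1// => v _.
  by rewrite leqNgt (leq_ltn_trans _ ab) ?mul0r// -ltnS ltn_ord.
rewrite mul1r -sum_bin_diag natr_sum.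
rewrite -(subnKC ab) -addnS big_split_ord /= big1 ?add0r => [|v _]; last first.
  by rewrite leqNgt ltn_ord mul0r.
rewrite addKn; apply: eq_bigr => v _.
by rewrite leq_addr mul1r addKn.
Qed.

(** The weights are expanded from the top: k is the first marked point whose term c_k is selected.
    Above it the chain is free and counted by [chains], below it all weights are kept; the binomial
    counts the chains where nothing is selected. *)
Lemma cumsum_point_weight m i b : (i <= m)%N ->
  cumsum w m i b = 'C(b + i, i)%:R +
    \sum_(k | (m - i <= d k < m)%N)
      chains (m - d k) (u k) b * (c k * cumsum w (d k) (i + d k - m) (u k)).
Proof.
elim: i m b => [|i IH] m b im.
  by rewrite bin0 big1 ?addr0// => k; rewrite subn0 leqNgt andNb.
case: m im => [//|m] /= im.
rewrite ltnS in im.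
under eq_bigr do rewrite [w m _]/w mulrDl mul1r.
rewrite big_split /=.
have E1 : \sum_(v < b.+1) cumsum w m i v = 'C(b + i.+1, i.+1)%:R +
    \sum_(k | (m - i <= d k < m)%N)
      chains (m.+1 - d k) (u k) b * (c k * cumsum w (d k) (i.+1 + d k - m.+1) (u k)).
  under eq_bigr do rewrite IH//.
  rewrite big_split /= -sum_bin_diag natr_sum; congr (_ + _).
  rewrite exchange_big /=; apply: eq_bigr => k /andP[_ km].
  by rewrite -mulr_suml sum_chains ?subn_gt0// -subSn ?(ltnW km)// addSn subSS.
rewrite E1 -addrA; congr (_ + _).
(* Points below the level just summed over are accounted for by induction; those on it come from the
   perturbation of the weight. *)
rewrite [RHS](bigID (fun k => (d k < m)%N)) /=; congr (_ + _).
  apply: eq_bigl => k; rewrite subSS; lia.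
under eq_bigr do rewrite mulr_suml.
rewrite exchange_big [RHS]big_mkcond /=; apply: eq_bigr => k _.
case: ifP => [H|H]; last first.
  rewrite big1// => v _; rewrite (_ : (d k == m) = false) /= ?mulr0 ?mul0r//.
  by apply/negbTE; move: H; rewrite subSS; lia.
have dm : d k = m by move: H; lia.
rewrite dm eqxx /= subSnn /chains /= addn0 bin0 mulr1 (_ : i.+1 + m - m.+1 = i)%N; last lia.
case: leqP => ub.
  rewrite mul1r (bigD1 (Ordinal (ub : u k < b.+1)%N))//= eqxx mulr1 big1 ?addr0// => v vk.
  rewrite (_ : (u k == v) = false) ?mulr0 ?mul0r//.
  by apply/negbTE; apply: contraNneq vk => E; apply/eqP/val_inj.
rewrite mul0r big1// => v _.
rewrite (_ : (u k == v) = false) ?mulr0 ?mul0r//; have := ltn_ord v; lia.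
Qed.

End expansion.

(** * Lagrange interpolation and reduction to the marked points *)

Section kernel.
Context {F : numFieldType} (N : nat) (a : int) (x : 'I_N -> nat).
Hypothesis x_inj : injective x.

Definition binomial_mx : 'M[F]_N := \matrix_(j, i) 'C(x j + i, i)%:R.

Definition lagrange_poly (j : 'I_N) : {poly F} :=
  (\prod_(i | i != j) ((x j)%:Z - (x i)%:Z)%:~R)^-1 *:
  \prod_(i | i != j) ('X - ((a + (x i)%:Z)%:~R)%:P).

Lemma lagrange_polyE i j : (lagrange_poly j).[(a + (x i)%:Z)%:~R] = (i == j)%:R.
Proof.
rewrite hornerZ horner_prod; have [->|ij] := eqVneq i j.
  rewrite [X in _ * X](eq_bigr (fun k => ((x j)%:Z - (x k)%:Z)%:~R)); last first.
    by move=> k _; rewrite hornerXsubC -rmorphB /=; congr (_%:~R); lia.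
  apply: mulVf; rewrite prodf_seq_neq0; apply/allP => k _; apply/implyP => kj.
  by rewrite intr_eq0 subr_eq0 eqz_nat (inj_eq x_inj) eq_sym.
by rewrite [X in _ * X](bigD1 i)//= hornerXsubC subrr mul0r mulr0.
Qed.

Lemma size_lagrange_poly j : (size (lagrange_poly j) <= N)%N.
Proof.
apply: (leq_trans (size_scale_leq _ _)).
rewrite -big_filter size_prod_XsubC size_filter.
rewrite [index_enum _]unlock -enumT.
have := count_predC (pred1 j) (enum 'I_N).
rewrite size_enum_ord count_uniq_mem ?enum_uniq// mem_enum /= add1n => E.
by apply: eq_leq; rewrite -[RHS]E.
Qed.

(** The coefficients of the j-th Lagrange polynomial in the rising basis form the j-th column of the
    inverse, as evaluation at the top particles shows. Since q differences lower every basis index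
    by q, the truncated sums are differences of that polynomial. *)
Lemma binomial_mx_inverse : exists2 H : 'M[F]_N, binomial_mx *m H = 1%:M &
  forall q v j, \sum_(i < N | (q <= i)%N) 'C(v + (i - q), i - q)%:R * H i j =
    iter q nabla (fun y => (lagrange_poly j).[y%:~R]) (a + v%:Z).
Proof.
have /fin_all_exists[h hE] j : exists h : nat -> F,
    lagrange_poly j = \sum_(i < N) h i *: rising_poly a i.
  exact/rising_poly_basis/size_lagrange_poly.
exists (\matrix_(i, j) h j i).
  apply/matrixP => i j; rewrite !mxE -lagrange_polyE hE horner_sum.
  by apply: eq_bigr => k _; rewrite !mxE hornerZ rising_poly_nat mulrC.
move=> q v j.
rewrite (@eq_iter_nabla _ _ _
  (fun y => \sum_(i < N) h j i * (rising_poly a i).[y%:~R])); last first.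
  by move=> y; rewrite hE horner_sum; apply: eq_bigr => k _; rewrite hornerZ.
rewrite iter_nabla_sum big_mkcond; apply: eq_bigr => i _.
rewrite iter_nablaZ iter_nabla_rising_poly mxE mulrC.
by case: ifP => _; rewrite ?mulr0// rising_poly_nat.
Qed.

Lemma binomial_mx_unit : binomial_mx \in unitmx.
Proof. by have [H /mulmx1_unit[]] := binomial_mx_inverse. Qed.

Context (s : nat) (d u : 'I_s -> nat).
Hypothesis d_lt : forall k, (d k < N)%N.

Definition transition_mx : 'M[F]_s :=
  \matrix_(l, k) ((d k < d l)%N%:R * chains (d l - d k) (u k) (u l)).

Definition kernel_mx : 'M[F]_s := \matrix_(l, k)
  (\sum_j iter (N - d l) nabla (fun y => (lagrange_poly j).[y%:~R]) (a + (u l)%:Z)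
     * chains (N - d k) (u k) (x j)) - transition_mx.

(* With [r] the values of the cumulated sums at the points, the weights enter
   through [M = M0 + V C r] and [r = U + Phi C r], where [Phi] is graded by the
   levels; Sylvester's identity turns [det M] into an [s]-dimensional one. *)
Lemma det_cumsum_kernel (c : 'I_s -> F) :
  \det (cumsum_mx (point_weight d u c) x) =
  \det binomial_mx * \det (1%:M + kernel_mx *m diag_mx (\row_k c k)).
Proof.
have [H MH UH] := binomial_mx_inverse.
set w := point_weight d u c; set C := diag_mx _.
pose V : 'M[F]_(N, s) := \matrix_(j, k) chains (N - d k) (u k) (x j).
pose U : 'M[F]_(s, N) := \matrix_(l, i)
  ((N - d l <= i)%N%:R * 'C(u l + (i - (N - d l)), i - (N - d l))%:R).
(* The indicator guards the truncated subtraction: [i + d l - N] is the number of sums left below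
   the l-th point in column i. *)
pose r : 'M[F]_(s, N) := \matrix_(l, i)
  ((N - d l <= i)%N%:R * cumsum w (d l) (i + d l - N) (u l)).
have ME : cumsum_mx w x = binomial_mx + V *m (C *m r).
  apply/matrixP => j i; rewrite !mxE cumsum_point_weight; last exact: ltnW.
  congr (_ + _); rewrite big_mkcond; apply: eq_bigr => k _.
  rewrite mul_diag_mx !mxE d_lt andbT; have := d_lt k => dk.
  rewrite (_ : (N - i <= d k) = (N - d k <= i))%N; last by lia.
  by case: ifP => _; rewrite ?mul1r// mul0r !mulr0.
have rE : r = U + transition_mx *m (C *m r).
  apply/matrixP => l i; rewrite !mxE.
  have iN := ltn_ord i; have dl := d_lt l.
  case: leqP => li; last first.
    rewrite !mul0r add0r big1// => k _; rewrite mul_diag_mx !mxE.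
    case: ltnP => [kl|_]; last by rewrite !mul0r.
    by rewrite [in X in _ * X]leqNgt (_ : (i < N - d k)%N); [rewrite mul0r !mulr0|lia].
  rewrite !mul1r cumsum_point_weight; last by lia.
  rewrite (_ : i + d l - N = i - (N - d l))%N; last by lia.
  congr (_ + _); rewrite big_mkcond; apply: eq_bigr => k _.
  rewrite mul_diag_mx !mxE.
  rewrite (_ : (d l - (i - (N - d l)) <= d k < d l)%N = (d k < d l)%N && (N - d k <= i)%N);
    last by lia.
  case: (ltnP (d k) (d l)) => kl /=; last by rewrite !mul0r.
  case: (leqP (N - d k) i) => ki; last by rewrite mul0r !mulr0.
  by rewrite !mul1r (_ : i - (N - d l) + d k - d l = i + d k - N)%N//; lia.
(* The recursion for [r] reads A r = U with det A = 1, so [r] can be eliminated without inverting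
   [A]. *)
pose A := 1%:M - transition_mx *m C.
have detA : \det A = 1.
  apply: (@det_1sub_graded _ _ d) => l k kl.
  by rewrite mul_mx_diag !mxE (negbTE kl) !mul0r.
have Ar : A *m r = U.
  by rewrite mulmxBl mul1mx -mulmxA; apply/eqP; rewrite subr_eq; apply/eqP.
have UHV : U *m H *m V = kernel_mx + transition_mx.
  rewrite subrK; apply/matrixP => l k; rewrite !mxE; apply: eq_bigr => j _.
  rewrite mxE; congr (_ * _); last by rewrite mxE.
  rewrite -UH [RHS]big_mkcond; apply: eq_bigr => i _; rewrite !mxE.
  by case: ifP => _; rewrite ?mul1r// !mul0r.
have -> : cumsum_mx w x = binomial_mx *m (1%:M + H *m V *m C *m r).
  by rewrite mulmxDr mulmx1 !mulmxA MH mul1mx -mulmxA.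
rewrite det_mulmx det_1addmulC; congr (_ * _).
(* Multiplication by [A] replaces A r by U; the term of [A] in [transition_mx] then cancels, which
   leaves 1 + K C. *)
rewrite -[LHS]mul1r -{1}detA -det_mulmx mulmxDr mulmx1.
rewrite !mulmxA Ar UHV mulmxDl /A.
by rewrite [kernel_mx *m C + _]addrC addrA subrK.
Qed.

End kernel.

(** * Inclusion-exclusion from avoided to occupied points *)

Section inclusion_exclusion.
Context {F : fieldType} (A : finType) (P : pred A) (s : nat).
Context (occ : 'I_s -> pred A) (K : 'M[F]_s) (Z : F).

Definition occupied_avoiding (S T : {set 'I_s}) (f : A) : bool :=
  [forall k in S, occ k f] && [forall k in T, ~~ occ k f].

(** Interpolates between 1 - K restricted to [T] and K; written transposed, so that the status of k
    affects row k only. *)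
Definition mixed_mx (S T : {set 'I_s}) : 'M[F]_s := \matrix_(k, l)
  if k \in S then K l k else (k == l)%:R - (k \in T)%:R * K l k.

Hypothesis avoiding_det : forall T : {set 'I_s},
  \sum_(f | P f) (occupied_avoiding set0 T f)%:R = Z * \det (mixed_mx set0 T).

(* Both sides satisfy a(S + k, T) = a(S, T) - a(S, T + k). *)
Lemma mixed_det (S T : {set 'I_s}) : [disjoint S & T] ->
  \sum_(f | P f) (occupied_avoiding S T f)%:R = Z * \det (mixed_mx S T).
Proof.
have [n] := ubnP #|S|; elim: n S T => // n IH S T Sn ST.
have [->|[k kS]] := set_0Vmem S; first exact: avoiding_det.
have kT : k \notin T by rewrite (disjointFr ST kS).
pose S' := S :\ k.
have kS' : k \notin S' by rewrite !inE eqxx.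
have S'n : (#|S'| < n)%N by move: Sn; rewrite (cardsD1 k S) kS add1n ltnS.
have S'T : [disjoint S' & T] by apply: disjointWl ST; exact: subD1set.
have S'Tk : [disjoint S' & k |: T].
  rewrite disjoint_sym disjoints_subset subUset sub1set inE kS' /=.
  by rewrite -disjoints_subset disjoint_sym.
have -> : \sum_(f | P f) (occupied_avoiding S T f)%:R =
    \sum_(f | P f) (occupied_avoiding S' T f)%:R -
    \sum_(f | P f) (occupied_avoiding S' (k |: T) f)%:R :> F.
  rewrite -sumrB; apply: eq_bigr => f _.
  have E1 : occupied_avoiding S T f = occ k f && occupied_avoiding S' T f.
    rewrite /occupied_avoiding andbA; congr (_ && _).
    apply/forall_inP/andP => [h|[h1 /forall_inP h2] l lS].
      by split; [exact: h|apply/forall_inP => l; rewrite !inE => /andP[_ /h]].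
    by have [->//|lk] := eqVneq l k; apply: h2; rewrite !inE lk.
  have E2 : occupied_avoiding S' (k |: T) f = ~~ occ k f && occupied_avoiding S' T f.
    rewrite /occupied_avoiding andbCA; congr (_ && _).
    apply/forall_inP/andP => [h|[h1 /forall_inP h2] l].
      by split; [apply: h; rewrite setU11|apply/forall_inP => l lT; apply: h; rewrite inE lT orbT].
    by rewrite !inE => /orP[/eqP->//|]; exact: h2.
  rewrite E1 E2; case: (occ k f); rewrite ?subr0//=.
  by case: occupied_avoiding; rewrite subrr.
rewrite !IH// -mulrBr; congr (_ * _).
(* Row k says K = delta - (delta - K); the other rows agree in all three matrices. *)
rewrite (@determinant_multilinear _ _ (mixed_mx S T) (mixed_mx S' T)
  (mixed_mx S' (k |: T)) k 1 (-1)) ?mul1r ?mulN1r//.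
- apply/rowP => l; rewrite !mxE kS (negbTE kS') (negbTE kT) setU11 /=.
  by rewrite mul0r subr0 mul1r mul1r mulN1r opprB addrC subrK.
- apply/matrixP => i l; rewrite !mxE.
  by rewrite !inE (eq_sym (lift k i) k) (negbTE (neq_lift _ _)).
- apply/matrixP => i l; rewrite !mxE.
  by rewrite !inE (eq_sym (lift k i) k) (negbTE (neq_lift _ _)).
Qed.

Lemma occupied_det :
  \sum_(f | P f) ([forall k, occ k f])%:R = Z * \det K.
Proof.
transitivity (\sum_(f | P f) (occupied_avoiding setT set0 f)%:R : F).
  apply: eq_bigr => f _; congr ((nat_of_bool _)%:R).
  apply/forallP/andP => [h|[/forall_inP h _] k]; last exact: h.
  by split; apply/forall_inP => k //; rewrite inE.
rewrite mixed_det; last by rewrite disjoint_sym disjoints_subset sub0set.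
rewrite -[in RHS]det_tr; congr (_ * \det _).
by apply/matrixP => i j; rewrite !mxE inE.
Qed.

End inclusion_exclusion.

(** * Counting the arrays through prescribed points *)

Section counting.
Context {F : numFieldType} (N L : nat) (a : int) (x : {ffun 'I_N -> 'I_L}).
Hypothesis x_dec : forall i j : 'I_N, (i < j)%N -> (x j < x i)%N.
Context (s : nat) (d u : 'I_s -> nat).
Hypotheses (d_lt : forall k, (d k < N)%N) (du_inj : injective (fun k => (d k, u k))).

Local Notation farray := {ffun tri N -> 'I_L}.
Local Notation top := (fun j => nat_of_ord (x j)).

Definition has_top (f : farray) : bool := interlacingb f && (row_top f == x).

Definition visits (k : 'I_s) (f : farray) : bool :=
  [exists p : tri N, (level p == d k) && (f p == u k :> nat)].

Lemma top_inj : injective top.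
Proof.
move=> i j ij; apply/val_inj; case: (ltngtP i j) => [/x_dec|/x_dec|//].
  by rewrite /= ij ltnn.
by rewrite /= ij ltnn.
Qed.

(** With c_k = -1 on [T] the weight drops to 0 at the points of [T]; their distinctness ensures that
    1 is subtracted only once. *)
Lemma point_weight_avoid (T : {set 'I_s}) m v :
  point_weight d u (fun k => - (k \in T)%:R) m v
  = [forall k in T, ~~ ((d k == m) && (u k == v))]%:R :> F.
Proof.
rewrite /point_weight; case: (boolP [forall k in T, _]) => [/forall_inP h|].
  rewrite big1 ?addr0// => k _; case: (boolP (k \in T)) => [/h/negbTE->|_].
    by rewrite mulr0.
  by rewrite oppr0 mul0r.
rewrite negb_forall => /existsP[k]; rewrite negb_imply negbK => /andP[kT /andP[/eqP dk /eqP uk]].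
rewrite (bigD1 k)//= kT dk uk !eqxx mulr1 big1 ?addr0 ?subrr// => l lk.
case: (boolP ((d l == m) && (u l == v))) => [/andP[/eqP dl /eqP ul]|_]; last by rewrite mulr0.
by case/eqP: lk; apply: du_inj; rewrite dl ul dk uk.
Qed.

Lemma array_weight_avoid (T : {set 'I_s}) (f : farray) :
  array_weight (point_weight d u (fun k => - (k \in T)%:R)) f
  = (occupied_avoiding visits set0 T f)%:R :> F.
Proof.
rewrite /array_weight; under eq_bigr do rewrite point_weight_avoid.
rewrite -natr_prod; congr (_%:R).
rewrite (_ : occupied_avoiding _ _ _ _ = [forall k in T, ~~ visits k f]); last first.
  rewrite /occupied_avoiding; case: [forall k in set0, _] / forall_inP => // -[].
  by move=> k; rewrite inE.
case: (boolP [forall k in T, ~~ visits k f]) => [/forall_inP h|].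
  rewrite big1// => p pN; case: (boolP [forall k in T, _]) => //.
  rewrite negb_forall => /existsP[k]; rewrite negb_imply negbK => /andP[/h + /andP[dk uk]].
  by move=> /existsP[]; exists p; rewrite eq_sym dk eq_sym uk.
rewrite negb_forall => /existsP[k]; rewrite negb_imply negbK => /andP[kT /existsP[p]].
(* The points lie below the top row, so [p] is among the weighted positions. *)
move=> /andP[/eqP dk /eqP uk]; rewrite (bigD1 p) /=; last by rewrite dk.
rewrite (_ : [forall k in T, _] = false) ?mul0n//; apply/negbTE.
by rewrite negb_forall; apply/existsP; exists k; rewrite negb_imply negbK kT dk uk !eqxx.
Qed.

Let K : 'M[F]_s := kernel_mx a top d u.

Lemma avoiding_det (T : {set 'I_s}) :
  \sum_(f | has_top f) (occupied_avoiding visits set0 T f)%:R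
  = (-1) ^+ 'C(N, 2) * \det (binomial_mx top) * \det (mixed_mx K set0 T) :> F.
Proof.
under eq_bigr do rewrite -array_weight_avoid.
rewrite /has_top sum_array_weight; last first.
  by move=> i j ij; apply/ltnW/x_dec; rewrite ij.
rewrite -mulrA (@det_cumsum_kernel _ _ a _ top_inj _ d u d_lt); congr (_ * (_ * _)).
rewrite -det_tr; congr (\det _); apply/matrixP => k l; rewrite [in RHS]mxE inE.
rewrite mxE mxE [X in X + _]mxE mul_mx_diag [X in _ + X]mxE [X in _ * X]mxE.
by rewrite mulrN mulrC eq_sym.
Qed.

Lemma card_has_top : #|[pred f | has_top f]|%:R = (-1) ^+ 'C(N, 2) * \det (binomial_mx top) :> F.
Proof.
have := avoiding_det set0.
rewrite (_ : mixed_mx K set0 set0 = 1%:M); last first.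
  by apply/matrixP => k l; rewrite !mxE !inE mul0r subr0.
rewrite det1 mulr1 => <-; rewrite -sum1_card natr_sum; apply: eq_bigr => f _.
rewrite (_ : occupied_avoiding _ _ _ _ = true)//.
by apply/andP; split; apply/forall_inP => k; rewrite inE.
Qed.

(** Lagrange interpolation inverts the binomial matrix, so arrays with this top row exist and one
    may divide by their number. *)
Lemma card_has_top_neq0 : #|[pred f | has_top f]|%:R != 0 :> F.
Proof.
rewrite card_has_top mulf_neq0// ?signr_eq0//.
by have := binomial_mx_unit (F := F) a top_inj; rewrite unitmxE unitfE.
Qed.

Lemma card_visits :
  #|[pred f | has_top f && [forall k, visits k f]]|%:R = #|[pred f | has_top f]|%:R * \det K.
Proof.
rewrite card_has_top -(occupied_det avoiding_det) -sum1_card natr_sum big_mkcondr.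
by apply: eq_bigr => f _; case: ifP.
Qed.

End counting.

(* Imported only here because [classical_sets] shadows [finset]. *)
From mathcomp Require Import finmap.
From mathcomp Require Import all_classical all_reals all_analysis.
From mathcomp Require Import complex measurable_realfun.

Import Order.TTheory GRing.Theory Num.Theory numFieldNormedType.Exports.

Local Open Scope classical_set_scope.
Local Open Scope ring_scope.
Local Open Scope complex_scope.

(** * Contour integrals of rational functions *)

Section piecewise_integration.
Context {R : realType}.
Local Notation mu := (@lebesgue_measure R).
Implicit Types (a b u v : R) (s : seq R) (h H : R -> R).

Definition on_pieces a s (Q : R -> R -> Prop) : Prop :=
  forall i, (i < size s)%N -> Q (nth 0 (a :: s) i) (nth 0 (a :: s) i.+1).

Lemma on_pieces_cons a x s Q :
  on_pieces a (x :: s) Q -> Q a x /\ on_pieces x s Q.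
Proof. by move=> h; split=> [|i si]; [exact: (h 0%N)|exact: (h i.+1)]. Qed.

(** The end points are negligible. This matters because the derivative of a piecewise smooth path is
    controlled only inside the pieces. *)
Lemma integrable_oo_cc u v h :
  mu.-integrable `]u, v[ (EFin \o h) -> mu.-integrable `[u, v] (EFin \o h).
Proof.
move=> ih.
have mh : measurable_fun `[u, v] h.
  apply: (@measurable_fun_itv_cc _ u v false true).
  by apply/measurable_EFinP; exact: (measurable_int mu).
have muN : mu [set u; v] = 0%E.
  by apply: countable_lebesgue_measure0; apply: finite_set_countable.
have mN : measurable [set u; v] by apply: measurableU; exact: measurable_set1.
have mEh : measurable_fun `[u, v] (EFin \o h) by exact/measurable_EFinP.
apply/(@negligible_integrable _ _ _ [the measure _ _ of mu] _ _ _ mN _ mEh muN) => //.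
apply: integrableS ih => //.
  by apply: measurableD.
move=> t [/=]; rewrite !in_itv/= => /andP[ut tv] /not_orP[/eqP nu /eqP nv].
by rewrite !lt_neqAle ut tv eq_sym nu nv.
Qed.

Lemma integrable_oc_cat a x b h : a <= x -> x <= b ->
  mu.-integrable `[a, x] (EFin \o h) -> mu.-integrable `]x, b] (EFin \o h) ->
  mu.-integrable `[a, b] (EFin \o h).
Proof.
move=> ax xb ih1 ih2.
rewrite (@itv_bndbnd_setU _ _ _ (BRight x)) ?bnd_simp//.
have /integrableP[m1 f1] := ih1; have /integrableP[m2 f2] := ih2.
apply/integrableP; split.
  by apply/measurable_funU.
rewrite ge0_integral_setU//; first by rewrite lte_add_pinfty.
  apply/measurable_funU => //; split; [move: m1|move: m2];
    exact: measurableT_comp.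
apply/disj_setPS => y [/=]; rewrite 2!in_itv/= => /andP[_ yx] /andP[].
by rewrite ltNge yx.
Qed.

Lemma integrable_on_pieces a b s h : itv_partition a b s -> 
  on_pieces a s (fun u v => mu.-integrable `[u, v] (EFin \o h)) ->
  mu.-integrable `[a, b] (EFin \o h).
Proof.
elim: s a => [|x s IH] a.
  move=> /itv_partition_nil -> _; rewrite set_itv1.
  apply: null_set_integrable => //; last exact: lebesgue_measure_set1.
  exact: measurable_fun_set1.
move=> abs /on_pieces_cons[hax hs].
have /= /andP[ax _] := proj1 abs.
have xbs := itv_partition_cons abs.
have xb := itv_partition_le xbs.
apply: (@integrable_oc_cat _ x); rewrite ?(ltW ax)//.
apply: integrableS (IH x xbs hs) => //.
by apply: subset_itvr; rewrite bnd_simp.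
Qed.

(** The boundary terms telescope over the partition. *)
Lemma Rintegral_on_pieces a b s h H : itv_partition a b s ->
  on_pieces a s (fun u v => mu.-integrable `[u, v] (EFin \o h)) ->
  on_pieces a s (fun u v => \int[mu]_(t in `[u, v]) h t = H v - H u) ->
  \int[mu]_(t in `[a, b]) h t = H b - H a.
Proof.
elim: s a => [|x s IH] a.
  move=> /itv_partition_nil -> _ _.
  by rewrite set_itv1 Rintegral_set1 subrr.
move=> abs ih /on_pieces_cons[Hax Hs].
have iab := integrable_on_pieces abs ih.
have [_ {}ih] := on_pieces_cons ih.
have /= /andP[ax _] := proj1 abs.
have xbs := itv_partition_cons abs.
have xb := itv_partition_le xbs.
have := @Rintegral_itvB _ h (BLeft a) (BRight b) x iab.
rewrite !bnd_simp (ltW ax) xb => /(_ isT isT) /(canRL (subrK _)) ->.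
rewrite Hax Rintegral_itv_obnd_cbnd; last first.
  by apply: integrableS iab => //; apply: subset_itvr; rewrite bnd_simp ltW.
by rewrite (IH x)// subrKA.
Qed.

Lemma integrable_piece u v h k : {within `[u, v], continuous k} ->
  {in `]u, v[, h =1 k} -> mu.-integrable `[u, v] (EFin \o h).
Proof.
move=> ck hk; apply: integrable_oo_cc.
have ik : mu.-integrable `[u, v] (EFin \o k).
  by apply: continuous_compact_integrable => //; exact: segment_compact.
apply: (@eq_integrable _ _ _ [the measure _ _ of mu] _ _ (EFin \o k)) => //.
  by move=> t; rewrite inE/= => tuv; rewrite /= hk.
by apply: integrableS ik => //; exact: subset_itv_oo_cc.
Qed.

Lemma Rintegral_piece u v h k H : u < v -> {within `[u, v], continuous k} ->
  {in `]u, v[, h =1 k} ->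
  {within `[u, v], continuous H} ->
  (forall t, t \in `]u, v[ -> is_derive t 1 H (h t)) ->
  \int[mu]_(t in `[u, v]) h t = H v - H u.
Proof.
move=> uv ck hk cH dH.
have ik : mu.-integrable `[u, v] (EFin \o k).
  by apply: continuous_compact_integrable => //; exact: segment_compact.
have ih := integrable_piece ck hk.
have mf f : mu.-integrable `[u, v] (EFin \o f) -> measurable_fun `]u, v[ f.
  move=> /(measurable_int mu)/measurable_EFinP.
  by apply: measurable_funS => //; exact: subset_itv_oo_cc.
rewrite /Rintegral (@eq_integral_itv_bounded _ u v k)//; try exact: mf.
rewrite (@continuous_FTC2 _ k H)//.
- have /(continuous_within_itvP _ uv)[_ Hu Hv] := cH.
  by split => // t tuv; have [] := dH _ tuv.
- by move=> t tuv; rewrite derive1E; have [_ ->] := dH _ tuv; rewrite hk.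
Qed.

End piecewise_integration.

(** * Calculus of complex paths through real and imaginary parts *)

Section complex_paths.
Context {R : realType}.
Local Notation mu := (@lebesgue_measure R).
Local Notation Re := complex.Re.
Local Notation Im := complex.Im.
Implicit Types (u v t : R) (s : seq R) (z w : R[i]) (f g F G : R -> R[i]).

Lemma Re_add z w : Re (z + w) = Re z + Re w. Proof. by case: z w => ? ? []. Qed.
Lemma Im_add z w : Im (z + w) = Im z + Im w. Proof. by case: z w => ? ? []. Qed.
Lemma Re_mul z w : Re (z * w) = Re z * Re w - Im z * Im w.
Proof. by case: z w => ? ? []. Qed.
Lemma Im_mul z w : Im (z * w) = Re z * Im w + Im z * Re w.
Proof. by case: z w => ? ? []. Qed.
Lemma Re_inv z : Re z^-1 = Re z / (Re z ^+ 2 + Im z ^+ 2). Proof. by case: z. Qed.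
Lemma Im_inv z : Im z^-1 = - Im z / (Re z ^+ 2 + Im z ^+ 2).
Proof. by case: z => a b; rewrite /= mulNr. Qed.

Lemma sqr_norm_neq0 z : z != 0 -> Re z ^+ 2 + Im z ^+ 2 != 0.
Proof.
case: z => a b; rewrite eq_complex /= negb_and => ab.
rewrite paddr_eq0 ?sqr_ge0// !sqrf_eq0 negb_and; exact: ab.
Qed.

Definition cwithin u v f : Prop :=
  {within `[u, v], continuous (fun t => Re (f t))} /\
  {within `[u, v], continuous (fun t => Im (f t))}.

Lemma cwithin_cst u v z : cwithin u v (fun=> z).
Proof. by split; move=> t; exact: cvg_cst. Qed.

(** Here and below the equations are between functions, so that after rewriting the rules for limits
    and derivatives of real sums, products and inverses apply. *)
Lemma ReD_fun f g :
  (fun t => Re (f t + g t)) = (fun t => Re (f t)) \+ (fun t => Re (g t)).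
Proof. by apply/funext => t; rewrite Re_add. Qed.
Lemma ImD_fun f g :
  (fun t => Im (f t + g t)) = (fun t => Im (f t)) \+ (fun t => Im (g t)).
Proof. by apply/funext => t; rewrite Im_add. Qed.
Lemma ReM_fun f g :
  (fun t => Re (f t * g t)) = (fun t => Re (f t)) * (fun t => Re (g t))
    - (fun t => Im (f t)) * (fun t => Im (g t)).
Proof. by apply/funext => t; rewrite Re_mul. Qed.
Lemma ImM_fun f g :
  (fun t => Im (f t * g t)) = (fun t => Re (f t)) * (fun t => Im (g t))
    + (fun t => Im (f t)) * (fun t => Re (g t)).
Proof. by apply/funext => t; rewrite Im_mul. Qed.
Lemma ReV_fun f : (fun t => Re (f t)^-1) =
  (fun t => Re (f t)) * (fun t => (Re (f t) * Re (f t) + Im (f t) * Im (f t))^-1).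
Proof. by apply/funext => t; rewrite Re_inv !expr2. Qed.
Lemma ImV_fun f : (fun t => Im (f t)^-1) =
  - ((fun t => Im (f t)) * (fun t => (Re (f t) * Re (f t) + Im (f t) * Im (f t))^-1)).
Proof. by apply/funext => t; rewrite Im_inv !expr2 mulNr. Qed.

Lemma cwithinD u v f g : cwithin u v f -> cwithin u v g ->
  cwithin u v (fun t => f t + g t).
Proof.
move=> [f1 f2] [g1 g2]; split; rewrite (ReD_fun, ImD_fun) => t.
  by apply: cvgD; [exact: f1|exact: g1].
by apply: cvgD; [exact: f2|exact: g2].
Qed.

Lemma cwithinM u v f g : cwithin u v f -> cwithin u v g ->
  cwithin u v (fun t => f t * g t).
Proof.
move=> [f1 f2] [g1 g2]; split; rewrite (ReM_fun, ImM_fun) => t.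
  by apply: cvgB; apply: cvgM; (exact: f1 || exact: g1 || exact: f2 || exact: g2).
by apply: cvgD; apply: cvgM; (exact: f1 || exact: g1 || exact: f2 || exact: g2).
Qed.

Lemma cwithinV u v f : (forall t, t \in `[u, v] -> f t != 0) ->
  cwithin u v f -> cwithin u v (fun t => (f t)^-1).
Proof.
move=> f0 [/subspace_continuousP f1 /subspace_continuousP f2].
have cn t : `[u, v]%classic t ->
    (fun t => (Re (f t) * Re (f t) + Im (f t) * Im (f t))^-1)
      @ within `[u, v] (nbhs t)
      --> (Re (f t) * Re (f t) + Im (f t) * Im (f t))^-1.
  move=> tuv; apply: cvgV; first by rewrite -!expr2; apply/sqr_norm_neq0/f0.
  by apply: cvgD; apply: cvgM; (exact: f1 || exact: f2).
split; apply/subspace_continuousP => t tuv; rewrite (ReV_fun, ImV_fun).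
  by apply: cvgM; [exact: f1|exact: cn].
by apply: cvgN; apply: cvgM; [exact: f2|exact: cn].
Qed.

Definition cis_derive t F z : Prop :=
  is_derive t 1 (fun t => Re (F t)) (Re z) /\
  is_derive t 1 (fun t => Im (F t)) (Im z).

Lemma cis_derive_cst t z : cis_derive t (fun=> z) 0.
Proof. by split; apply: is_derive_cst. Qed.

Lemma cis_deriveD t F G z w : cis_derive t F z -> cis_derive t G w ->
  cis_derive t (fun t => F t + G t) (z + w).
Proof.
move=> [F1 F2] [G1 G2].
by split; rewrite (ReD_fun, ImD_fun) (Re_add, Im_add); exact: is_deriveD.
Qed.

Lemma cis_deriveM t F G z w : cis_derive t F z -> cis_derive t G w ->
  cis_derive t (fun t => F t * G t) (z * G t + F t * w).
Proof.
move=> [F1 F2] [G1 G2]; split; rewrite (ReM_fun, ImM_fun).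
  apply: is_derive_eq; rewrite Re_add !Re_mul /GRing.scale /=; ring.
by apply: is_derive_eq; rewrite Im_add !Im_mul /GRing.scale /=; ring.
Qed.

Lemma cis_deriveV t F z : F t != 0 -> cis_derive t F z ->
  cis_derive t (fun t => (F t)^-1) (- (F t) ^- 2 * z).
Proof.
move=> /sqr_norm_neq0; rewrite !expr2 => F0 [F1 F2].
have nE : is_derive t 1 (fun t => Re (F t) * Re (F t) + Im (F t) * Im (F t))
    (2 * Re (F t) * Re z + 2 * Im (F t) * Im z).
  by apply: is_derive_eq; rewrite /GRing.scale /=; ring.
have nV := @is_deriveV _
  (fun t => Re (F t) * Re (F t) + Im (F t) * Im (F t)) t _ 1 F0 nE.
have E : - (F t) ^- 2 * z = - ((F t)^-1 * (F t)^-1 * z).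
  by rewrite -exprVn expr2 mulNr.
have ReN x : Re (- x) = - Re x by case: x.
have ImN x : Im (- x) = - Im x by case: x.
split; rewrite (ReV_fun, ImV_fun); apply: is_derive_eq.
  by rewrite E ReN !(Re_mul, Im_mul) Re_inv Im_inv !expr2 /GRing.scale /=; field.
by rewrite E ImN !(Re_mul, Im_mul) Re_inv Im_inv !expr2 /GRing.scale /=; field.
Qed.

End complex_paths.

Lemma on_pieces_bounds (R : realType) (a b : R) s : itv_partition a b s ->
  on_pieces a s (fun u v => [/\ a <= u, u < v & v <= b]).
Proof.
elim: s a => // x s IH a abs [|i] /=.
  have /= /andP[ax _] := proj1 abs.
  by split=> //; exact: itv_partition_le (itv_partition_cons abs).
rewrite ltnS => si; have /= /andP[ax _] := proj1 abs.
have [xu uv vb] := IH x (itv_partition_cons abs) i si.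
by split=> //; apply: le_trans xu; exact: ltW.
Qed.

(** * Integration along a closed piecewise smooth path *)

Section contour.
Context {R : realType} (g : R -> R[i]).
Local Notation mu := (@lebesgue_measure R).
Local Notation Re := complex.Re.
Local Notation Im := complex.Im.
Hypotheses (g_C1 : piecewise_C1 g) (g_closed : g 0 = g 1).
Implicit Types (f : R[i] -> R[i]) (F : R -> R[i]) (z w a : R[i]).

Let s := proj1_sig (cid2 g_C1).
Let sP : itv_partition 0 1 s := s2valP (cid2 g_C1).

Let g_pieces : on_pieces 0 s (fun u v => [/\ 0 <= u, u < v, v <= 1 & cwithin u v g /\
  exists2 dg, cwithin u v dg & forall t, t \in `]u, v[ ->
    cis_derive t g (dg t) /\ cderive1 g t = dg t]).
Proof.
move=> i si.
have [u0 uv v1] := on_pieces_bounds sP si; split => //.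
have [[cRe [dRe cdRe hRe]] [cIm [dIm cdIm hIm]]] := s2valP' (cid2 g_C1) i si.
split=> //; exists (fun t => dRe t +i* dIm t) => // t tuv; split.
  by split; [exact: hRe|exact: hIm].
rewrite /cderive1 !derive1E.
by have [_ ->] := hRe t tuv; have [_ ->] := hIm t tuv.
Qed.

Let trace_piece i t (u := nth 0 (0 :: s) i) (v := nth 0 (0 :: s) i.+1) :
  (i < size s)%N -> t \in `[u, v]%R -> trace g (g t).
Proof.
move=> si; have [u0 _ v1 _] := g_pieces si.
rewrite in_itv => /andP[ut tv]; exists t => //=.
by rewrite in_itv/= (le_trans u0)//= (le_trans tv).
Qed.

(** The regularity asked of integrands: it implies integrability and is stable under the algebraic
    operations. *)
Definition path_cont f := on_pieces 0 s (fun u v => cwithin u v (fun t => f (g t))).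

Lemma path_cont_cst z : path_cont (fun=> z).
Proof. by move=> i si; exact: cwithin_cst. Qed.

Lemma path_cont_id : path_cont id.
Proof. by move=> i si; have [_ _ _ []] := g_pieces si. Qed.

Lemma path_contD f1 f2 : path_cont f1 -> path_cont f2 ->
  path_cont (fun z => f1 z + f2 z).
Proof. by move=> h1 h2 i si; apply: cwithinD; [exact: h1|exact: h2]. Qed.

Lemma path_contM f1 f2 : path_cont f1 -> path_cont f2 ->
  path_cont (fun z => f1 z * f2 z).
Proof. by move=> h1 h2 i si; apply: cwithinM; [exact: h1|exact: h2]. Qed.

Lemma path_contV f : (forall z, trace g z -> f z != 0) -> path_cont f ->
  path_cont (fun z => (f z)^-1).
Proof.
move=> f0 h i si; apply: cwithinV; last exact: h.
by move=> t tuv; apply: f0; exact: trace_piece tuv.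
Qed.

Lemma path_cont_horner (p : {poly R[i]}) : path_cont (horner p).
Proof.
elim/poly_ind: p => [|p c IH].
  by rewrite (_ : horner 0 = fun=> 0); [exact: path_cont_cst|
    apply/funext => z; rewrite horner0].
rewrite (_ : horner _ = fun z => p.[z] * z + c); last first.
  by apply/funext => z; rewrite hornerMXaddC.
apply: path_contD; last exact: path_cont_cst.
exact: path_contM path_cont_id.
Qed.

Definition cintegrable F : Prop := mu.-integrable `[0, 1] (EFin \o (fun t => Re (F t)))
  /\ mu.-integrable `[0, 1] (EFin \o (fun t => Im (F t))).

Lemma cintegralD F1 F2 : cintegrable F1 -> cintegrable F2 ->
  cintegral (fun t => F1 t + F2 t) = cintegral F1 + cintegral F2.
Proof.
move=> [h1 h2] [h3 h4].
rewrite /cintegral; apply/eqP; rewrite eq_complex /= ReD_fun ImD_fun.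
by rewrite !RintegralD// !eqxx.
Qed.

Lemma cintegralZ z F : cintegrable F -> cintegral (fun t => z * F t) = z * cintegral F.
Proof.
move=> [h1 h2]; rewrite /cintegral; case: z => a b.
have E c (h : R -> R) : mu.-integrable `[0, 1] (EFin \o h) ->
    mu.-integrable `[0, 1] (EFin \o (fun t => c * h t)).
  move=> ih.
  have := @integrableZl _ _ _ [the measure _ _ of mu] `[0,1] (measurable_itv _) c _ ih.
  exact.
apply/eqP; rewrite eq_complex /=.
under eq_Rintegral do rewrite Re_mul/=.
under [X in _ && (X == _)]eq_Rintegral do rewrite Im_mul/=.
rewrite RintegralB//; [|exact: E|exact: E].
rewrite RintegralD//; [|exact: E|exact: E].
by rewrite !RintegralZl// !eqxx.
Qed.

Let piece_integrable f i (u := nth 0 (0 :: s) i) (v := nth 0 (0 :: s) i.+1) :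
  path_cont f -> (i < size s)%N ->
  mu.-integrable `[u, v] (EFin \o (fun t => Re (f (g t) * cderive1 g t))) /\
  mu.-integrable `[u, v] (EFin \o (fun t => Im (f (g t) * cderive1 g t))).
Proof.
move=> cf si; have [_ _ _ [_ [dg cdg dgP]]] := g_pieces si.
have [c1 c2] := cwithinM (cf i si) cdg.
by split; [apply: (integrable_piece c1)|apply: (integrable_piece c2)] => t tuv;
  have [_ ->] := dgP t tuv.
Qed.

Lemma path_cont_integrable f : path_cont f ->
  cintegrable (fun t => f (g t) * cderive1 g t).
Proof.
by move=> cf; split; apply: (integrable_on_pieces sP) => i si;
  have [] := piece_integrable cf si.
Qed.

Lemma eq_contour_integral f1 f2 : (forall z, trace g z -> f1 z = f2 z) ->
  contour_integral g f1 = contour_integral g f2.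
Proof.
move=> f12; rewrite /contour_integral /cintegral.
by congr Complex; apply: eq_Rintegral => t; rewrite inE => tuv;
  rewrite f12//; exists t.
Qed.

Lemma contour_integralD f1 f2 : path_cont f1 -> path_cont f2 ->
  contour_integral g (fun z => f1 z + f2 z)
    = contour_integral g f1 + contour_integral g f2.
Proof.
move=> /path_cont_integrable h1 /path_cont_integrable h2.
rewrite /contour_integral -cintegralD//; congr cintegral.
by apply/funext => t; rewrite mulrDl.
Qed.

Lemma contour_integralZ z f : path_cont f ->
  contour_integral g (fun w => z * f w) = z * contour_integral g f.
Proof.
move=> /path_cont_integrable h1.
rewrite /contour_integral -cintegralZ//; congr cintegral.
by apply/funext => t; rewrite mulrA.
Qed.

(** The fundamental theorem on each piece, telescoped around the closed path. The derivative of [G]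
    is asked for along the trace only, so poles off the contour are allowed. *)
Lemma contour_integral_primitive f G df : path_cont f -> path_cont G ->
  (forall t dg, trace g (g t) -> cis_derive t g dg ->
    cis_derive t (fun t => G (g t)) (df (g t) * dg)) ->
  (forall z, trace g z -> f z = df z) ->
  contour_integral g f = 0.
Proof.
move=> cf cG dG fdf.
have h i (si : (i < size s)%N) : let u := nth 0 (0 :: s) i in
    let v := nth 0 (0 :: s) i.+1 in
    (\int[mu]_(t in `[u, v]) Re (f (g t) * cderive1 g t) = Re (G (g v)) - Re (G (g u))) /\
    (\int[mu]_(t in `[u, v]) Im (f (g t) * cderive1 g t) = Im (G (g v)) - Im (G (g u))).
  have [_ uv _ [_ [dg cdg dgP]]] := g_pieces si.
  have [c1 c2] := cwithinM (cf i si) cdg.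
  have [G1 G2] := cG i si.
  split; [apply: (@Rintegral_piece _ _ _ _ _ (fun t => Re (G (g t))) uv c1) |
    apply: (@Rintegral_piece _ _ _ _ _ (fun t => Im (G (g t))) uv c2)] => //.
  - by move=> t tuv; have [_ ->] := dgP t tuv.
  - move=> t tuv; have [gt ->] := dgP t tuv.
    have tr : trace g (g t) by apply: (trace_piece si); exact: subset_itv_oo_cc.
    by rewrite fdf//; have [] := dG t _ tr gt.
  - by move=> t tuv; have [_ ->] := dgP t tuv.
  - move=> t tuv; have [gt ->] := dgP t tuv.
    have tr : trace g (g t) by apply: (trace_piece si); exact: subset_itv_oo_cc.
    by rewrite fdf//; have [] := dG t _ tr gt.
rewrite /contour_integral /cintegral.
rewrite (@Rintegral_on_pieces _ _ _ _ _ (fun t => Re (G (g t))) sP); first last.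
- by move=> i si; have [] := h i si.
- by move=> i si; have [] := piece_integrable cf si.
rewrite (@Rintegral_on_pieces _ _ _ _ _ (fun t => Im (G (g t))) sP); first last.
- by move=> i si; have [] := h i si.
- by move=> i si; have [] := piece_integrable cf si.
by rewrite g_closed !subrr.
Qed.
End contour.

(** * Partial fractions with simple poles *)

Section partial_fractions.
Context {F : fieldType}.
Implicit Types (p : {poly F}) (rs : seq F).

(** The residue at a simple pole [a] of [p] divided by the product of the X - b. *)
Definition pole_coef p rs (a : F) : F := p.[a] / \prod_(b <- rs | b != a) (a - b).

Lemma horner_prod_XsubC (rs : seq F) (P : pred F) (x : F) :
  (\prod_(b <- rs | P b) ('X - b%:P)).[x] = \prod_(b <- rs | P b) (x - b).
Proof. by rewrite horner_prod; apply: eq_bigr => b _; rewrite !hornerE. Qed.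

Lemma size_prod_XsubC_cond (rs : seq F) (P : pred F) :
  size (\prod_(b <- rs | P b) ('X - b%:P)) = (count P rs).+1.
Proof. by rewrite -big_filter size_prod_XsubC size_filter. Qed.

(** The sum interpolates [p] at the distinct points of [rs] and has smaller degree than the product,
    so it is the remainder of the division. *)
Lemma partial_fractions p rs : uniq rs ->
  p = (p %/ \prod_(a <- rs) ('X - a%:P)) * \prod_(a <- rs) ('X - a%:P)
      + \sum_(a <- rs) pole_coef p rs a *: \prod_(b <- rs | b != a) ('X - b%:P).
Proof.
move=> urs; set Q := \prod_(a <- rs) _; set S := \sum_(a <- rs) _.
have szS : (size S < size Q)%N.
  rewrite size_prod_XsubC ltnS; apply: (leq_trans (size_sum _ _ _)).
  apply/bigmax_leqP_seq => a ars _; apply: (leq_trans (size_scale_leq _ _)).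
  rewrite size_prod_XsubC_cond.
  have := count_predC (pred1 a) rs; rewrite count_uniq_mem// ars => <-.
  by [].
have Qdvd : Q %| p - S.
  apply: uniq_roots_dvdp; last by rewrite uniq_rootsE.
  apply/allP => a ars; rewrite /root !hornerE subr_eq0 horner_sum.
  rewrite (bigD1_seq a)//= hornerZ horner_prod_XsubC divfK; last first.
    by rewrite prodf_seq_neq0; apply/allP => b _; apply/implyP; rewrite subr_eq0 eq_sym.
  rewrite big1 ?addr0// => b ba; rewrite hornerZ horner_prod_XsubC.
  by rewrite (big_rem a)//= eq_sym ba subrr mul0r mulr0.
have Q0 : Q != 0 by rewrite -size_poly_eq0 size_prod_XsubC.
have /eqP pE := Qdvd; rewrite -[in LHS](subrK S p) (divp_eq (p - S) Q) pE addr0.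
congr (_ * _ + _); rewrite -[in RHS](subrK S p) -(divpK Qdvd).
by rewrite mulpK// divp_addl_mul_small.
Qed.

Lemma partial_fractions_horner p rs x : uniq rs -> x \notin rs ->
  p.[x] / \prod_(a <- rs) (x - a) = (p %/ \prod_(a <- rs) ('X - a%:P)).[x]
    + \sum_(a <- rs) pole_coef p rs a * (x - a)^-1.
Proof.
move=> urs xrs.
have nz (P : pred F) : \prod_(a <- rs | P a) (x - a) != 0.
  rewrite prodf_seq_neq0; apply/allP => b brs; apply/implyP => _.
  by rewrite subr_eq0; apply: contraNneq xrs => ->.
rewrite [in LHS](partial_fractions p urs) hornerD hornerM horner_prod_XsubC.
rewrite mulrDl mulfK//; congr (_ + _); rewrite horner_sum mulr_suml.
apply: eq_big_seq => a ars; rewrite hornerZ horner_prod_XsubC -mulrA; congr (_ * _).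
by rewrite [in X in _ / X](bigD1_seq a)//= invfM mulrCA mulfV// mulr1.
Qed.

Lemma antiderivative_poly p : (forall n, n.+1%:R != 0 :> F) -> exists q, q^`() = p.
Proof.
move=> n0; exists (\poly_(i < (size p).+1) (p`_i.-1 / i%:R)).
apply/polyP => i; rewrite coef_deriv coef_poly ltnS.
case: ltnP => [_|pi]; last by rewrite mul0rn nth_default.
by rewrite -[p`_i / _ *+ _]mulr_natr divfK.
Qed.
End partial_fractions.

(** * Residue calculus for rational functions *)

Section residues.
Context {R : realType} (g : R -> R[i]).
Hypotheses (g_C1 : piecewise_C1 g) (g_closed : g 0 = g 1).
Implicit Types (a z : R[i]) (p : {poly R[i]}) (rs : seq R[i]).

Lemma two_pi_i_neq0 : two_pi_i R != 0.
Proof. by rewrite eq_complex /= eqxx /= mulf_neq0// gt_eqF// pi_gt0. Qed.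

Lemma contour_integral_inv a :
  contour_integral g (fun z => (z - a)^-1) = two_pi_i R * winding g a.
Proof. by rewrite /winding mulVKf// two_pi_i_neq0. Qed.

Lemma path_cont_subr a : path_cont g_C1 (fun z => z - a).
Proof. by apply: path_contD; [exact: path_cont_id|exact: path_cont_cst]. Qed.

Lemma path_cont_inv a : ~ trace g a -> path_cont g_C1 (fun z => (z - a)^-1).
Proof.
move=> ga; apply: path_contV; last exact: path_cont_subr.
by move=> z gz; rewrite subr_eq0; apply/eqP => za; rewrite -za in ga.
Qed.

Lemma cis_derive_horner p t dg : cis_derive t g dg ->
  cis_derive t (fun t => p.[g t]) (p^`().[g t] * dg).
Proof.
move=> gt; elim/poly_ind: p => [|p c IH].
  rewrite (_ : (fun t => _) = fun=> 0); last by apply/funext => u; rewrite horner0.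
  by rewrite deriv0 horner0 mul0r; exact: cis_derive_cst.
rewrite (_ : (fun t => _) = fun t => p.[g t] * g t + c); last first.
  by apply/funext => u; rewrite hornerMXaddC.
rewrite (_ : _ * dg = p^`().[g t] * dg * g t + p.[g t] * dg + 0).
  exact: cis_deriveD (cis_deriveM IH gt) (cis_derive_cst t c).
by rewrite derivD derivC addr0 derivM derivX mulr1 !hornerE; ring.
Qed.

Lemma contour_integral_poly p : contour_integral g (fun z => p.[z]) = 0.
Proof.
have [q qp] := @antiderivative_poly _ p (fun n => lt0r_neq0 (ltr0Sn _ n)).
apply: (@contour_integral_primitive _ _ g_C1 g_closed _ (horner q) (horner p)) => //.
- exact: path_cont_horner.
- exact: path_cont_horner.
- by move=> t dg _ gt; rewrite -qp; exact: cis_derive_horner.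
Qed.

(** The integrand has the primitive -1/(z - a) along the contour. *)
Lemma contour_integral_double_pole a : ~ trace g a ->
  contour_integral g (fun z => (z - a)^-1 * (z - a)^-1) = 0.
Proof.
move=> ga.
apply: (@contour_integral_primitive _ _ g_C1 g_closed _ (fun z => (-1) * (z - a)^-1)
  (fun z => (z - a)^-1 * (z - a)^-1)) => //.
- by apply: path_contM; exact: path_cont_inv.
- by apply: path_contM; [exact: path_cont_cst|exact: path_cont_inv].
- move=> t dg gt dgt.
  have ne : g t - a != 0 by rewrite subr_eq0; apply/eqP => E; rewrite -E in ga.
  have d1 := cis_deriveD dgt (cis_derive_cst t (- a)).
  have d2 := cis_deriveM (cis_derive_cst t (-1)) (cis_deriveV ne d1).
  rewrite (_ : _ * dg = 0 * (g t - a)^-1 + -1 * (- (g t - a) ^- 2 * (dg + 0)))//.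
  by rewrite -exprVn expr2; ring.
Qed.

Lemma contour_integral_sum (I : eqType) (r : seq I) (f : I -> R[i] -> R[i]) :
  (forall i, i \in r -> path_cont g_C1 (f i)) ->
  path_cont g_C1 (fun z => \sum_(i <- r) f i z) /\
  contour_integral g (fun z => \sum_(i <- r) f i z)
    = \sum_(i <- r) contour_integral g (f i).
Proof.
elim: r => [|i r IH] rc.
  rewrite (_ : (fun z => _) = horner 0); last first.
    by apply/funext => z; rewrite big_nil horner0.
  by rewrite big_nil contour_integral_poly; split => //; exact: path_cont_horner.
have [|c1 c2] := IH; first by move=> j jr; apply: rc; rewrite inE jr orbT.
have ci := rc i (mem_head i r).
rewrite (_ : (fun z => _) = fun z => f i z + \sum_(j <- r) f j z); last first.
  by apply/funext => z; rewrite big_cons.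
split; first exact: path_contD.
by rewrite big_cons (contour_integralD ci c1) c2.
Qed.

(** After partial fractions the polynomial part has a primitive, and each simple pole contributes
    its winding number by definition. *)
Theorem residue_theorem p rs : uniq rs -> (forall a, a \in rs -> ~ trace g a) ->
  contour_integral g (fun z => p.[z] / \prod_(a <- rs) (z - a))
    = two_pi_i R * \sum_(a <- rs) pole_coef p rs a * winding g a.
Proof.
move=> urs rsg; set q := p %/ \prod_(a <- rs) ('X - a%:P).
have grs z : trace g z -> z \notin rs by move=> gz; apply/negP => /rsg.
transitivity (contour_integral g (fun z => q.[z]
    + \sum_(a <- rs) pole_coef p rs a * (z - a)^-1)).
  by apply: eq_contour_integral => z /grs zrs; exact: partial_fractions_horner.
have cf a : a \in rs -> path_cont g_C1 (fun z => pole_coef p rs a * (z - a)^-1).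
  by move=> /rsg ars; apply: path_contM; [exact: path_cont_cst|exact: path_cont_inv].
have [|c1 c2] := @contour_integral_sum _ rs (fun a z => pole_coef p rs a * (z - a)^-1).
  by move=> a /cf.
rewrite (contour_integralD (path_cont_horner q) c1) contour_integral_poly add0r c2.
rewrite mulr_sumr; apply: eq_big_seq => a /rsg ars.
by rewrite (contour_integralZ _ (path_cont_inv ars)) contour_integral_inv mulrCA.
Qed.

(** For distinct points partial fractions give the difference of two winding numbers equal to 1; for
    equal ones there is a double pole. *)
Lemma contour_integral_inv_inv a z : encloses g a -> encloses g z ->
  contour_integral g (fun w => (w - a)^-1 * (w - z)^-1) = 0.
Proof.
move=> [ga wa] [gz wz].
have [<-|az] := eqVneq a z; first exact: contour_integral_double_pole.
transitivity (contour_integral g (fun w => (a - z)^-1 * ((w - a)^-1 + (-1) * (w - z)^-1))).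
  apply: eq_contour_integral => w gw.
  have wa0 : w - a != 0 by rewrite subr_eq0; apply/eqP => E; rewrite -E in ga.
  have wz0 : w - z != 0 by rewrite subr_eq0; apply/eqP => E; rewrite -E in gz.
  have az0 : a - z != 0 by rewrite subr_eq0.
  by field; rewrite wa0 wz0.
have cz : path_cont g_C1 (fun w => (-1) * (w - z)^-1).
  by apply: path_contM; [exact: path_cont_cst|exact: path_cont_inv].
have ca := path_cont_inv ga.
rewrite (contour_integralZ _ (path_contD ca cz)) (contour_integralD ca cz).
rewrite (contour_integralZ _ (path_cont_inv gz)) !contour_integral_inv wa wz.
by rewrite mulN1r subrr mulr0.
Qed.

(* All poles, including [z], are enclosed, so only the polynomial part of
   [p / prod (w - a)] contributes; [z] may be one of the [a]s. *)
Lemma contour_integral_outer p rs z : uniq rs -> encloses g z ->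
  (forall a, a \in rs -> encloses g a) ->
  contour_integral g (fun w => p.[w] / \prod_(a <- rs) (w - a) * (w - z)^-1)
    = two_pi_i R * (p %/ \prod_(a <- rs) ('X - a%:P)).[z].
Proof.
move=> urs ez ers; set q := p %/ \prod_(a <- rs) ('X - a%:P).
have [gz wz] := ez.
have grs w : trace g w -> w \notin rs by move=> gw; apply/negP => /ers[].
(* Division of [q] by w - z isolates the value q(z), the only contribution that survives
   integration. *)
have [q1 q1E] : exists q1, q = q1 * ('X - z%:P) + (q.[z])%:P.
  have /factor_theorem[q1 E] : root (q - (q.[z])%:P) z by rewrite /root !hornerE subrr.
  by exists q1; rewrite -E subrK.
transitivity (contour_integral g (fun w => q1.[w] + (q.[z] * (w - z)^-1
    + \sum_(a <- rs) pole_coef p rs a * ((w - a)^-1 * (w - z)^-1)))).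
  apply: eq_contour_integral => w gw.
  have wz0 : w - z != 0 by rewrite subr_eq0; apply/eqP => E; rewrite -E in gz.
  rewrite (partial_fractions_horner p urs (grs _ gw)) -/q mulrDl mulr_suml addrA.
  congr (_ + _); last by apply: eq_bigr => a _; rewrite mulrA.
  by rewrite [in LHS]q1E !hornerE mulrDl mulfK.
have cz : path_cont g_C1 (fun w => q.[z] * (w - z)^-1).
  by apply: path_contM; [exact: path_cont_cst|exact: path_cont_inv].
have c0 a : a \in rs -> path_cont g_C1 (fun w => (w - a)^-1 * (w - z)^-1).
  by move=> /ers[ga _]; apply: path_contM; exact: path_cont_inv.
have [|c1 c2] := @contour_integral_sum _ rs
    (fun a w => pole_coef p rs a * ((w - a)^-1 * (w - z)^-1)).
  by move=> a /c0 ?; apply: path_contM => //; exact: path_cont_cst.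
rewrite (contour_integralD (path_cont_horner q1) (path_contD cz c1)).
rewrite contour_integral_poly add0r (contour_integralD cz c1) c2.
rewrite (contour_integralZ _ (path_cont_inv gz)) contour_integral_inv wz mulr1 mulrC.
rewrite big_seq big1 ?addr0// => a ars.
by rewrite (contour_integralZ _ (c0 _ ars)) contour_integral_inv_inv ?mulr0//; exact: ers.
Qed.

End residues.

(** * Identification of the kernel *)

Section kernel_value.
Context {R : realType} (N : nat) (nu : N.-tuple int).
Hypothesis nu_noninc : forall i j : nat, (1 <= i)%N -> (i <= j)%N -> (j <= N)%N ->
  part nu j <= part nu i.

Definition top_row : seq int := [seq part nu r - r%:Z | r <- index_iota 1 N.+1].

Lemma top_row_bounds t : t \in top_row -> part nu N - N%:Z <= t <= part nu 1 - 1.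
Proof.
move=> /mapP[r]; rewrite mem_index_iota => /andP[r1 rN] ->.
have := @nu_noninc 1 r isT r1 rN; have := @nu_noninc r N r1 rN (leqnn _).
lia.
Qed.

Lemma uniq_top_row : uniq top_row.
Proof.
rewrite map_inj_in_uniq ?iota_uniq// => i j.
rewrite !mem_index_iota => /andP[i1 iN] /andP[j1 jN] E.
have [ij|ji|//] := ltngtP i j.
  by have := @nu_noninc i j i1 (ltnW ij) jN; lia.
by have := @nu_noninc j i j1 (ltnW ji) iN; lia.
Qed.

Local Notation C := R[i].
Local Notation tops := [seq (t%:~R : C) | t <- top_row].

Definition top_poly : {poly C} := \prod_(t <- top_row) ('X - (t%:~R)%:P).

Definition node_poly (x : int) (q : nat) : {poly C} :=
  \prod_(k < q.+1) ('X - ((x - k%:Z)%:~R)%:P).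

Definition poch_poly (y : C) (m : nat) : {poly C} := \prod_(k < m) ('X + (y + k%:R)%:P).

Lemma horner_poch_poly y m z : (poch_poly y m).[z] = pochhammer (z + y) m.
Proof. by rewrite horner_prod; apply: eq_bigr => k _; rewrite hornerD hornerX hornerC addrA. Qed.

Lemma pochhammer_nodes (x : int) q (w : C) :
  pochhammer (w - x%:~R) q.+1 =
    \prod_(a <- [seq ((x - k%:Z)%:~R : C) | k <- index_iota 0 q.+1]) (w - a).
Proof.
rewrite big_map big_mkord; apply: eq_bigr => k _.
by rewrite rmorphB /= -pmulrn; ring.
Qed.

Lemma contour_kernel x1 n1 x2 n2 (gz gw : R -> C) :
  z_contour nu x2 gz -> w_contour N x1 n1 gz gw ->
  (two_pi_i R ^+ 2)^-1 * contour_integral gz (fun z =>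
     contour_integral gw (fun w => integrand nu x1 n1 x2 n2 z w)) =
  \sum_(t <- top_row | x2 <= t)
    pochhammer (t - x2 + 1)%:~R (N - n2 - 1)
    * (top_poly %/ node_poly x1 (N - n1)).[t%:~R]
    / \prod_(b <- top_row | b != t) (t - b)%:~R.
Proof.
move=> [[gz_C1 gz_closed _ _] gz_in gz_out] [[gw_C1 gw_closed _ _] gw_gz gw_nodes].
set nodes := [seq ((x1 - k%:Z)%:~R : C) | k <- index_iota 0 (N - n1).+1].
have utops : uniq tops by rewrite map_inj_uniq ?uniq_top_row//; exact: intr_inj.
have unodes : uniq nodes.
  rewrite /nodes map_inj_uniq ?iota_uniq// => i j /intr_inj; lia.
have en a : a \in nodes -> encloses gw a.
  by move=> /mapP[k]; rewrite mem_index_iota => /andP[_ kN] ->; exact: gw_nodes.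
have trw w a : trace gw w -> a \in nodes -> w - a != 0.
  by move=> tw /en[ga _]; rewrite subr_eq0; apply/eqP => E; rewrite -E in ga.
have node_polyE : node_poly x1 (N - n1) = \prod_(a <- nodes) ('X - a%:P).
  by rewrite big_map big_mkord.
have top_polyE : top_poly = \prod_(a <- tops) ('X - a%:P) by rewrite big_map.
set A := _ %/ _.
have inner z : trace gz z ->
    contour_integral gw (fun w => integrand nu x1 n1 x2 n2 z w)
    = (two_pi_i R *: (poch_poly (1 - x2%:~R) (N - n2 - 1) * A)).[z]
      / \prod_(a <- tops) (z - a).
  move=> tz; rewrite (@eq_contour_integral _ _ _ (fun w =>
    (pochhammer (z - x2%:~R + 1) (N - n2 - 1) / \prod_(a <- tops) (z - a))
    * (top_poly.[w] / \prod_(a <- nodes) (w - a) * (w - z)^-1))); last first.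
    move=> w tw; rewrite /integrand addn1 pochhammer_nodes -/nodes.
    rewrite big_split/= [X in _ * X](_ : _ = top_poly.[w] / \prod_(a <- tops) (z - a)).
      by rewrite mulrACA -!mulrA; congr (_ * _); ring.
    rewrite top_polyE horner_prod_XsubC prodfV !big_map; congr (_ / _);
      by apply: eq_bigr => r _; rewrite rmorphB /= -pmulrn; ring.
  rewrite (contour_integralZ (g_C1 := gw_C1)).
    rewrite (contour_integral_outer gw_C1 gw_closed _ unodes (gw_gz _ tz) en).
    rewrite -node_polyE -/A hornerZ hornerM horner_poch_poly.
    rewrite (_ : z + (1 - x2%:~R) = z - x2%:~R + 1); last by ring.
    by move: (\prod_(a <- tops) _)^-1 => d; ring.
  apply: path_contM; first apply: path_contM; first exact: path_cont_horner.
    rewrite (_ : (fun w => _) = fun w => (\prod_(a <- nodes) ('X - a%:P)).[w]^-1).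
      apply: path_contV; last exact: path_cont_horner.
      move=> w tw; rewrite horner_prod_XsubC prodf_seq_neq0.
      by apply/allP => a /(trw _ _ tw) ->.
    by apply/funext => w; rewrite horner_prod_XsubC.
  by apply: path_cont_inv => //; have [] := gw_gz _ tz.
(* The top particles lie between nu_N - N and nu_1 - 1, the range in which the z-contour is
   prescribed to separate the integers at x2. *)
have t_enc t : t \in top_row -> if x2 <= t then encloses gz (t%:~R) else excludes gz (t%:~R).
  move=> /top_row_bounds/andP[tN t1]; case: leP => xt; first exact: gz_in.
  by apply: gz_out => //; lia.
have -> : contour_integral gz (fun z =>
     contour_integral gw (fun w => integrand nu x1 n1 x2 n2 z w)) = contour_integral gz (fun z =>
   (two_pi_i R *: (poch_poly (1 - x2%:~R) (N - n2 - 1) * A)).[z]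
      / \prod_(a <- tops) (z - a)) by exact: eq_contour_integral.
rewrite (residue_theorem gz_C1 gz_closed _ utops); last first.
  by move=> a /mapP[t /t_enc + ->]; case: ifP => _ [].
rewrite mulr_sumr mulr_sumr big_map [RHS]big_mkcond/=; apply: eq_big_seq => t tt.
rewrite /pole_coef big_map hornerZ hornerM horner_poch_poly.
have := t_enc t tt; case: ifP => xt [_ ->]; last by rewrite !mulr0.
rewrite mulr1 (_ : t%:~R + (1 - x2%:~R) = (t - x2 + 1)%:~R); last first.
  by rewrite !rmorphD/= rmorphN/=; ring.
rewrite (eq_bigl (fun b => b != t)); last first.
  by move=> b /=; rewrite (inj_eq (@intr_inj _)).
rewrite [X in _ = _ / X](eq_bigr (fun b : int => t%:~R - b%:~R)); last first.
  by move=> b _; rewrite rmorphB.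
have := two_pi_i_neq0 (R := R); move: (two_pi_i R) => c c0.
by move: (\prod_(i <- top_row | _) _)^-1 => d; field.
Qed.

End kernel_value.

(** Moves counting from sets of integer arrays to a finite type. As [E] is the image of a finite
    set, the default value of [fset_set] on infinite sets does not occur. *)
Lemma card_fset_set_image (A : finType) (B : choiceType) (h : A -> B) (P : pred A)
    (E : set B) : injective h ->
  (forall b, E b <-> exists2 f, P f & h f = b) -> #|` fset_set E|%fset = #|P|.
Proof.
move=> h_inj EP.
have -> : E = [set` [fset b in [seq h f | f <- enum P]]%fset].
  apply/seteqP; split => b.
    move=> /EP[f Pf <-] /=; rewrite inE/=; apply: map_f; by rewrite mem_enum.
  rewrite /= inE/= => /mapP[f]; rewrite mem_enum => Pf ->; apply/EP; by exists f.
rewrite set_fsetK card_fseq undup_id ?size_map -?cardE//.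
by rewrite map_inj_uniq ?enum_uniq.
Qed.

Lemma chains_pochhammer (F : numFieldType) (e b c : nat) :
  chains e b c = (b <= c)%N%:R *
    (pochhammer ((c%:Z - b%:Z + 1)%:~R) e.-1 / (e.-1)`!%:R) :> F.
Proof.
rewrite /chains; case: leqP => bc; rewrite ?mul0r// !mul1r.
rewrite -(rising_poly_nat 0) rising_polyE; congr (_ / _); apply: eq_bigr => k _.
rewrite (pmulrn 1 k) -!rmorphD /=; congr (_%:~R); lia.
Qed.

(** * Return to integer arrays and comparison of the two kernels *)

Section assembly.
Context {R : realType} (N : nat) (nu : N.-tuple int).
Hypotheses (N_gt0 : (0 < N)%N)
  (nu_noninc : forall i j : nat, (1 <= i)%N -> (i <= j)%N -> (j <= N)%N ->
     part nu j <= part nu i).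

(** Each entry is squeezed between two entries of the row above, so the bounds of the top row
    propagate downwards. *)
Lemma arrays_bounds (g : array N) (p : tri N) : arrays nu g ->
  part nu N - N%:Z <= g p <= part nu 1 - 1.
Proof.
move=> [gi gt].
have [k] : exists k, (level p + k = N)%N by exists (N - level p)%N; rewrite subnKC ?level_le.
elim: k p => [|k IH] p lp.
  rewrite addn0 in lp; rewrite gt//.
  have rN : (rank p <= N)%N by apply: leq_trans (rank_le p) _; rewrite lp.
  have r1 : (1 <= rank p)%N by [].
  have := nu_noninc (leqnn 1) r1 rN; have := nu_noninc r1 rN (leqnn N); lia.
have lN : (level p < N)%N by move: lp; clear; lia.
have lqk : ((level p).+1 + k)%N = N by rewrite addSnnS.
have rp := rank_le p.
have [|q [lq rq]] := @tri_exists N (level p).+1 (rank p) _ lN.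
  by rewrite leqW.
have [|q' [lq' rq']] := @tri_exists N (level p).+1 (rank p).+1 _ lN.
  by rewrite ltnS.
have [h1 _] := gi p q lq; have [_ h2] := gi p q' lq'.
have := IH q; rewrite lq => /(_ lqk); have := IH q'; rewrite lq' => /(_ lqk).
by move: (h1 rq) (h2 rq'); lia.
Qed.

Context (a : int) (L : nat).
Hypotheses (a_le : a <= part nu N - N%:Z) (L_gt : part nu 1 - a <= L%:Z).

Fact top_bound (j : 'I_N) : (absz (part nu j.+1 - j.+1%:Z - a)%R < L)%N.
Proof.
have := nu_noninc (leqnn 1) (ltn0Sn j) (ltn_ord j).
have := nu_noninc (ltn0Sn j) (ltn_ord j) (leqnn N).
have := ltn_ord j; lia.
Qed.

Definition top_positions : {ffun 'I_N -> 'I_L} := [ffun j => Ordinal (top_bound j)].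

Lemma top_positionsE j : a + (top_positions j)%:Z = part nu j.+1 - j.+1%:Z.
Proof.
rewrite ffunE /=.
have := nu_noninc (ltn0Sn j) (ltn_ord j) (leqnn N); have := ltn_ord j; lia.
Qed.

Lemma top_positions_dec (i j : 'I_N) : (i < j)%N -> (top_positions j < top_positions i)%N.
Proof.
move=> ij; have := top_positionsE i; have := top_positionsE j.
have := @nu_noninc i.+1 j.+1 isT (ltnW ij) (ltn_ord j); lia.
Qed.

(** All positions of all arrays in [arrays nu] lie in [a, a + L), so each of them is the shift of a
    finite one. *)
Definition shift_array (f : {ffun tri N -> 'I_L}) : array N := [ffun p => a + (f p)%:Z].

Lemma shift_array_inj : injective shift_array.
Proof.
move=> f g /ffunP fg; apply/ffunP => p; apply/val_inj => /=.
by have := fg p; rewrite !ffunE => /addrI[].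
Qed.

Lemma interlacing_shift f : interlacing (shift_array f) <-> interlacingb f.
Proof.
split=> [h|/interlacingbP h]; first apply/interlacingbP; move=> p q pq;
  have [h1 h2] := h p q pq; split=> r; [move: (h1 r)|move: (h2 r)|move: (h1 r)|move: (h2 r)];
  rewrite !ffunE; lia.
Qed.

Lemma arrays_shift f : arrays nu (shift_array f) <-> has_top top_positions f.
Proof.
split=> [[/interlacing_shift fi ft]|/andP[/interlacing_shift fi /eqP ft]].
  rewrite /has_top fi; apply/eqP/ffunP => j; rewrite ffunE; apply/val_inj => /=.
  have := ft (top_index j) (level_top j); rewrite ffunE rank_top -top_positionsE.
  lia.
split=> // p pN; rewrite (top_indexP pN) ffunE rank_top -top_positionsE -ft ffunE.
by [].
Qed.

Lemma arrays_image g : arrays nu g <-> exists2 f, has_top top_positions f & shift_array f = g.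
Proof.
split=> [ag|[f /arrays_shift + <-]//].
have bd p : (absz (g p - a)%R < L)%N by have := arrays_bounds p ag; lia.
pose f : {ffun tri N -> 'I_L} := [ffun p => Ordinal (bd p)].
have fg : shift_array f = g.
  apply/ffunP => p; rewrite !ffunE /= gez0_abs; first by rewrite addrC subrK.
  have /andP[h _] := arrays_bounds p ag; rewrite subr_ge0; exact: le_trans a_le h.
by exists f => //; apply/arrays_shift; rewrite fg.
Qed.

Context (s : nat) (y : 'I_s -> int) (n : 'I_s -> nat).
Hypotheses (yn_inj : injective (fun i => (y i, n i)))
  (n_bounds : forall i, (1 <= n i <= N.-1)%N) (a_le_y : forall i, a <= y i).

Definition shifted (i : 'I_s) : nat := absz (y i - a).

Lemma shiftedE i : a + (shifted i)%:Z = y i.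
Proof. by have := a_le_y i; rewrite /shifted; lia. Qed.

Lemma occupied_shift f : occupied y n (shift_array f) <-> forall k, visits n shifted k f.
Proof.
split=> h k.
  have [p [lp yp]] := h k; apply/existsP; exists p; rewrite lp eqxx /=.
  by move: yp; rewrite ffunE -shiftedE => /addrI[->].
have /existsP[p /andP[/eqP lp /eqP fp]] := h k.
by exists p; rewrite ffunE fp shiftedE.
Qed.

Lemma n_lt k : (n k < N)%N.
Proof. by have := n_bounds k; lia. Qed.

Lemma shifted_inj : injective (fun k => (n k, shifted k)).
Proof.
by move=> i j [nij sij]; apply: yn_inj; rewrite -!shiftedE sij nij.
Qed.

(** The nonzero number of all arrays is a factor of the numerator and cancels. *)
Lemma uniform_arrays_det :
  (uniform_arrays R nu (occupied y n))%:C = \det (kernel_mx a (fun j => top_positions j) n shifted).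
Proof.
rewrite /uniform_arrays.
rewrite (card_fset_set_image (P := has_top top_positions) shift_array_inj arrays_image).
rewrite (card_fset_set_image
  (P := [pred f | has_top top_positions f && [forall k, visits n shifted k f]]) shift_array_inj); last first.
  move=> g; split=> [[/arrays_image[f hf <-] /occupied_shift og]|[f /andP[hf /forallP fk] <-]].
    by exists f => //; rewrite /= hf; apply/forallP.
  by split; [apply/arrays_image; exists f|apply/occupied_shift].
rewrite rmorphM fmorphV !rmorph_nat /=.
rewrite (card_visits (F := R[i]) a top_positions_dec n_lt shifted_inj).
by rewrite mulrC mulKf// (card_has_top_neq0 (F := R[i]) a top_positions_dec n_lt shifted_inj).
Qed.

Lemma top_row_enum : top_row nu = [seq a + (top_positions j)%:Z | j <- enum 'I_N].
Proof.
rewrite /top_row /index_iota subn1 /= (iotaDl 1 0) -val_enum_ord -!map_comp.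
by apply: eq_map => j; rewrite /= top_positionsE add1n.
Qed.

(** [transition_mx] gives the first summand of the kernel. In the second, the Pochhammer symbol over
    (N - n2 - 1)! counts the chains from x2 to t, and (N - n1)! turns the quotient at t into a
    difference of order N - n1. *)
Lemma kernel_mxE (gz gw : R -> R[i]) l k :
  z_contour nu (y k) gz -> w_contour N (y l) (n l) gz gw ->
  kernel_mx a (fun j => top_positions j) n shifted l k
  = corr_kernel nu gz gw (y l) (n l) (y k) (n k) :> R[i].
Proof.
move=> gzP gwP; rewrite /corr_kernel (contour_kernel nu_noninc (n k) gzP gwP).
rewrite mxE mxE [X in _ + X]mxE [X in - X]mxE addrC; congr (_ + _).
  rewrite chains_pochhammer -!mulrA -subn1; congr (- (_ * (_ * (_ / _)))).
    by congr (_%:R); rewrite -!shiftedE lerD2l lez_nat.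
  congr (pochhammer (_%:~R) _); rewrite -!shiftedE; ring.
rewrite top_row_enum big_map mulr_sumr [RHS]big_mkcond big_enum /=.
apply: eq_bigr => j _; rewrite chains_pochhammer.
set t := a + (top_positions j)%:Z.
have -> : (shifted k <= top_positions j)%N = (y k <= t) by rewrite -shiftedE lerD2l lez_nat.
case: ifP => _; last by rewrite mul0r mulr0.
(* [G] is the unnormalized Lagrange polynomial of t, and X - t times [G] is the full top polynomial,
   as [quotient_nabla] requires. *)
pose G : {poly R[i]} := \prod_(i | i != j) ('X - ((a + (top_positions i)%:Z)%:~R)%:P).
have -> : top_poly nu = ('X - (t%:~R)%:P) * G.
  by rewrite /top_poly top_row_enum big_map big_enum (bigD1 j).
have := quotient_nabla t (y l) (N - n l) G; rewrite /= -/(node_poly _ _).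
move: (_ %/ _).[_] => A AE.
rewrite (@eq_iter_nabla _ _ _ (fun z : int =>
  (\prod_(i | i != j) ((top_positions j)%:Z - (top_positions i)%:Z)%:~R)^-1 * G.[z%:~R])).
  rewrite iter_nablaZ shiftedE -AE mul1r -subn1.
  rewrite (_ : t - y k = (top_positions j)%:Z - (shifted k)%:Z); last first.
    by rewrite /t -shiftedE; ring.
  rewrite big_map big_enum_cond /= [X in _ = _ * (_ / X)](_ : _ =
    \prod_(i | i != j) ((top_positions j)%:Z - (top_positions i)%:Z)%:~R); last first.
    apply: eq_big => [i|i _]; last by congr (_%:~R); rewrite /t; ring.
    by rewrite (inj_eq (@addrI _ a)) eqz_nat (inj_eq (top_inj top_positions_dec)).
  move: (\prod_(i | _) _)^-1 (_`!%:R^-1) => c e; ring.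
by move=> z; rewrite hornerZ.
Qed.

End assembly.

Theorem theorem5p1 (R : realType) (N : nat) (nu : N.-tuple int)
    (N_gt0 : (0 < N)%N)
    (nu_noninc : forall i j : nat, (1 <= i)%N -> (i <= j)%N -> (j <= N)%N ->
       part nu j <= part nu i)
    (gz gw : int -> nat -> int -> nat -> R -> R[i])
    (gzP : forall (x1 : int) (n1 : nat) (x2 : int) (n2 : nat),
       (1 <= n1 <= N)%N -> (1 <= n2 <= N.-1)%N ->
       z_contour nu x2 (gz x1 n1 x2 n2))
    (gwP : forall (x1 : int) (n1 : nat) (x2 : int) (n2 : nat),
       (1 <= n1 <= N)%N -> (1 <= n2 <= N.-1)%N ->
       w_contour N x1 n1 (gz x1 n1 x2 n2) (gw x1 n1 x2 n2)) :
  determinantal nu (fun x1 n1 x2 n2 =>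
    corr_kernel nu (gz x1 n1 x2 n2) (gw x1 n1 x2 n2) x1 n1 x2 n2).
Proof.
move=> s y n yn_inj n_bounds.
(* [m] bounds every |y i|, so that the origin [a] is at most every top particle and every given
   point. *)
pose m : nat := \sum_i `|y i|%N.
pose a : int := - `|part nu N - N%:Z| - m%:Z.
pose L : nat := absz (part nu 1 - a).
have a_le : a <= part nu N - N%:Z by rewrite /a; lia.
have a_le_y i : a <= y i.
  have : (`|y i|%N <= m)%N by rewrite /m (bigD1 i)//= leq_addr.
  rewrite /a; lia.
have L_gt : part nu 1 - a <= L%:Z by rewrite /L; lia.
rewrite (uniform_arrays_det N_gt0 nu_noninc a_le L_gt yn_inj n_bounds a_le_y).
congr (\det _); apply/matrixP => l k; rewrite [RHS]mxE.
have nl : (1 <= n l <= N)%N by have := n_bounds l; lia.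
by apply: kernel_mxE => //; [exact: gzP|exact: gwP].
Qed.
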